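(* Let $f\in W$ and, for each $n\ge 1$, let $u_n\in W$ be the solution of the Neumann problem $$ \begin{aligned} f(x) ={}& \chi_{A_n}(x)\int_{A_n} J(x,y)(u_n(y)-u_n(x))\,dy + \chi_{A_n}(x)\int_{B_n} R(x,y)(u_n(y)-u_n(x))\,dy\\ &+\chi_{B_n}(x)\int_{A_n} R(x,y)(u_n(y)-u_n(x))\,dy+\chi_{B_n}(x)\int_{B_n} G(x,y)(u_n(y)-u_n(x))\,dy,\qquad x\in\Omega . \end{aligned} $$ Assume $\chi_{A_n}\to X$ weakly-* in $L^\infty(\Omega)$ and that there exist constants $c_0>0$ and $c_1>0$ such that $$1-c_1\ge X(x)\ge c_0>0\qquad\text{for all }x\in\Omega .$$ Let $(u_A,u_B)$ be the weak limits in $L^2(\Omega)$ of $(\chi_{A_n}u_n,\chi_{B_n}u_n)$, and set $$\omega_n(x)=\frac{\chi_{A_n}(x)u_A(x)}{X(x)}+\frac{\chi_{B_n}(x)u_B(x)}{1-X(x)} .$$ Then $$\Big\|u_n-\Big(\omega_n-\int_\Omega\omega_n\,dx\Big)\Big\|_{L^2(\Omega)}\to0\qquad\text{as }n\to+\infty .$$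
   Context: $\Omega\subset\mathbb{R}^N$ is a bounded domain (open, connected). The kernels $V=J,G,R$ each satisfy: $V:\mathbb{R}^N\times\mathbb{R}^N\to\mathbb{R}$ is continuous and non-negative, $V(x,x)>0$ for every $x$, $V(x,y)=V(y,x)$ for all $x,y$, and $\int_{\mathbb{R}^N}V(x,y)\,dy=1$ for every $x$. For each $n\ge1$, $A_n,B_n$ are measurable sets with $\Omega=A_n\cup B_n$ and $A_n\cap B_n=\emptyset$; $\chi_E$ denotes the characteristic function of $E$. $W=\{u\in L^2(\Omega):\int_\Omega u\,dx=0\}$. Equations are understood for a.e. $x\in\Omega$. Under the weak-* convergence, the weak limits $u_A$ of $\chi_{A_n}u_n$ and $u_B$ of $\chi_{B_n}u_n$ in $L^2(\Omega)$ exist, and $(u_A,u_B)$ is the unique pair in $L^2(\Omega)\times L^2(\Omega)$ with $\int_\Omega(u_A+u_B)\,dx=0$ solving, for $x\in\Omega$, $$X(x)f(x)=\int_\Omega J(x,y)[X(x)u_A(y)-X(y)u_A(x)]dy+\int_\Omega R(x,y)[X(x)u_B(y)-u_A(x)(1-X(y))]dy,$$ $$(1-X(x))f(x)=\int_\Omega R(x,y)[u_A(y)(1-X(x))-u_B(x)X(y)]dy+\int_\Omega G(x,y)[u_B(y)(1-X(x))-u_B(x)(1-X(y))]dy.$$ *)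

(* Defs.v *)
From HB Require Import structures.
From mathcomp Require Import all_boot all_order all_algebra.
From mathcomp Require Import all_classical all_reals all_analysis.

Set Implicit Arguments.
Unset Strict Implicit.
Unset Printing Implicit Defensive.

Import Order.TTheory GRing.Theory Num.Theory.
Import numFieldNormedType.Exports.

Local Open Scope classical_set_scope.
Local Open Scope ring_scope.

(* Lebesgue measure on K^d is built on 'rV[K]_N.+1, d = N.+1 >= 1, from the
   outer measure defined by countable covers by boxes, via Caratheodory's
   theorem; accordingly [measurable] means Lebesgue (not merely Borel)
   measurable.  The topology of 'rV[K]_N.+1 is that of the max norm, i.e. the
   Euclidean one, with the same bounded sets. *)
Section lebesgue_outer_measure.
Context {K : realType} {N : nat}.
Local Notation E := 'rV[K]_N.+1.

Definition box (c : E * E) : set E :=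
  [set x | forall i, x ord0 i \in `]c.1 ord0 i, c.2 ord0 i] ].

Definition box_volume (c : E * E) : K :=
  \prod_(i < N.+1) Num.max 0 (c.2 ord0 i - c.1 ord0 i).

Definition box_cover (A : set E) : set (nat -> E * E) :=
  [set c | A `<=` \bigcup_k box (c k)].

Local Open Scope ereal_scope.

Definition lebesgue_outer (A : set E) : \bar K :=
  ereal_inf [set \sum_(k <oo) (box_volume (c k))%:E | c in box_cover A].

Lemma box_volume_ge0 c : 0 <= (box_volume c)%:E.
Proof. by rewrite lee_fin; apply: prodr_ge0 => i _; rewrite le_max lexx. Qed.

Lemma box_volume00 : box_volume (0, 0)%R = 0%R.
Proof. by rewrite /box_volume big_ord_recl subrr maxxx mul0r. Qed.

Lemma lebesgue_outer_ge0 A : 0 <= lebesgue_outer A.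
Proof.
apply: le_ereal_inf_tmp => _ [c _ <-].
by apply: nneseries_ge0 => k _ _; exact: box_volume_ge0.
Qed.

Lemma lebesgue_outer0 : lebesgue_outer set0 = 0.
Proof.
apply/eqP; rewrite eq_le lebesgue_outer_ge0 andbT.
apply: ereal_inf_lbound; exists (fun=> (0, 0)%R) => //.
by apply: eseries0 => k _ _; rewrite box_volume00.
Qed.

Lemma le_lebesgue_outer : {homo lebesgue_outer : A B / A `<=` B >-> A <= B}.
Proof.
move=> A B AB; apply/ereal_inf_le_tmp => x [c Bc <-].
by exists c => //; exact: subset_trans AB Bc.
Qed.

Lemma lebesgue_outer_sigma_subadditive : sigma_subadditive lebesgue_outer.
Proof.
move=> A; have [[i ioo]|] := pselect (exists i, lebesgue_outer (A i) = +oo).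
  rewrite (eseries_pinfty _ _ ioo) ?leey// => n _.
  by rewrite -ltNye (lt_le_trans _ (lebesgue_outer_ge0 _)).
rewrite -forallNE => Aoo.
suff add2e (e : {posnum K}) : lebesgue_outer (\bigcup_n A n) <=
    \sum_(i <oo) lebesgue_outer (A i) + e%:num%:E.
  by apply/lee_addgt0Pr => _/posnumP[].
rewrite (le_trans _ (epsilon_trick _ _ _))//; last first.
  by move=> n; exact: lebesgue_outer_ge0.
pose P n (c : nat -> E * E) := box_cover (A n) c /\
  \sum_(k <oo) (box_volume (c k))%:E <=
  lebesgue_outer (A n) + (e%:num / (2 ^ n.+1)%:R)%:E.
have [G PG] : {G : nat -> nat -> E * E & forall n, P n (G n)}.
  apply: (@choice _ _ P) => n; rewrite /P /lebesgue_outer.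
  set S := (X in ereal_inf X).
  have Sfin : ereal_inf S \is a fin_num.
    rewrite ge0_fin_numE; last exact: lebesgue_outer_ge0.
    by rewrite ltey; apply/eqP; exact: Aoo.
  have en1 : (0 < e%:num / (2 ^ n.+1)%:R)%R by [].
  have [x [c Ac cx] xS] := lb_ereal_inf_adherent en1 Sfin.
  by exists c; split => //; rewrite cx; exact/ltW.
pose v (p : nat * nat) : \bar K := (box_volume (G p.1 p.2))%:E.
have v0 p : 0 <= v p by exact: box_volume_ge0.
apply: (@le_trans _ _ (\esum_(i in setT) v i)).
  apply: ereal_inf_lbound => /=.
  have /card_esym/ppcard_eqP[f] := card_nat2.
  exists (fun k => G (f k).1 (f k).2).
    move=> t [i _] /(PG i).1[j _ Bt].
    by exists (f^-1%FUN (i, j)) => //=; rewrite invK ?inE.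
  rewrite -(esum_pred_image v _ xpredT) ?[fun=> _]set_true//.
  by rewrite image_eq.
rewrite (_ : esum _ _ = \sum_(i <oo) \sum_(j <oo) v (i, j)); last first.
  pose J : nat -> set (nat * nat) := fun i => [set (i, j) | j in setT].
  rewrite (_ : setT = \bigcup_k J k); last first.
    by rewrite predeqE => -[a b]; split => // _; exists a => //; exists b.
  rewrite esum_bigcupT //=; last first.
    apply/trivIsetP => i j _ _ ij.
    rewrite predeqE => -[n m] /=; split => //= -[] [_] _ [<-{n} _].
    by move=> [m' _] [] /esym/eqP; rewrite (negbTE ij).
  rewrite -(image_id [set: nat]) -fun_true esum_pred_image//; last first.
    by move=> n _; exact: esum_ge0.
  apply: eq_eseriesr => /= j _.
  rewrite -(esum_pred_image v (pair j) predT)//=; last first.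
    by move=> ? ? _ _; exact: (@can_inj _ _ _ snd).
  by congr esum; rewrite predeqE => -[a b]; split; move=> [i _ <-]; exists i.
apply: lee_nneseries => [n _ _|n _]; first exact: nneseries_ge0.
exact: (PG n).2.
Qed.

HB.instance Definition _ := isOuterMeasure.Build K E lebesgue_outer
  lebesgue_outer0 lebesgue_outer_ge0 le_lebesgue_outer
  lebesgue_outer_sigma_subadditive.

End lebesgue_outer_measure.

Section lebesgue_measure_space.
Context {K : realType} {N : nat}.
Local Notation outer := (@lebesgue_outer K N).

HB.instance Definition _ := @isMeasurable.Build (caratheodory_display outer)
  'rV[K]_N.+1 outer.-caratheodory
  (caratheodory_measurable_set0 outer)
  (@caratheodory_measurable_setC _ _ outer)
  (@caratheodory_measurable_bigcup _ _ outer).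

Definition lebesgue : set 'rV[K]_N.+1 -> \bar K := outer.

HB.instance Definition _ := isMeasure.Build _ _ _ lebesgue
  (@caratheodory_measure0 _ _ outer) (@caratheodory_measure_ge0 _ _ outer)
  (@caratheodory_measure_sigma_additive _ _ outer).

End lebesgue_measure_space.

Section function_spaces.
Context {K : realType} {N : nat}.
Local Notation E := 'rV[K]_N.+1.
Implicit Types (Omega : set E) (p : \bar K).

(* Functions on Omega are represented by functions on the whole space whose
   values outside Omega are irrelevant: they are replaced by 0. *)
Definition Lspace_on Omega p : set (E -> K) :=
  [set u | u \_ Omega \in Lfun (@lebesgue K N) p].

Definition Lnorm_on Omega p (u : E -> K) : \bar K :=
  Lnorm (@lebesgue K N) p (EFin \o (u \_ Omega)).

Definition mean_zero_L2 Omega : set (E -> K) :=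
  [set u | Lspace_on Omega 2%:E u /\ \int[lebesgue]_(x in Omega) u x = 0].

Definition weak_cvg_L2 Omega (v : nat -> E -> K) (w : E -> K) : Prop :=
  [/\ forall n, Lspace_on Omega 2%:E (v n), Lspace_on Omega 2%:E w &
    forall phi : E -> K, Lspace_on Omega 2%:E phi ->
      \int[lebesgue]_(x in Omega) (v n x * phi x) @[n --> \oo]
        --> \int[lebesgue]_(x in Omega) (w x * phi x)].

Definition weakstar_cvg_Loo Omega (v : nat -> E -> K) (w : E -> K) : Prop :=
  [/\ forall n, Lspace_on Omega +oo%E (v n), Lspace_on Omega +oo%E w &
    forall phi : E -> K, Lspace_on Omega 1%:E phi ->
      \int[lebesgue]_(x in Omega) (v n x * phi x) @[n --> \oo]
        --> \int[lebesgue]_(x in Omega) (w x * phi x)].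

Definition bounded_domain Omega : Prop :=
  [/\ open Omega, connected Omega & bounded_set Omega].

Definition admissible_kernel (V : E -> E -> K) : Prop :=
  [/\ continuous (fun z : E * E => V z.1 z.2),
      forall x y, 0 <= V x y,
      forall x, 0 < V x x,
      forall x y, V x y = V y x &
      forall x, (\int[lebesgue]_y (V x y)%:E = 1)%E].

Definition solves_neumann Omega (J G R : E -> E -> K) (A B : set E)
    (f u : E -> K) : Prop :=
  {ae lebesgue, forall x, Omega x ->
    f x = \1_A x * \int[lebesgue]_(y in A) (J x y * (u y - u x))
        + \1_A x * \int[lebesgue]_(y in B) (R x y * (u y - u x))
        + \1_B x * \int[lebesgue]_(y in A) (R x y * (u y - u x))
        + \1_B x * \int[lebesgue]_(y in B) (G x y * (u y - u x))}.

Definition corrector (A B : set E) (X uA uB : E -> K) (x : E) : K :=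
  \1_A x * uA x / X x + \1_B x * uB x / (1 - X x).

End function_spaces.

(* Main.v *)
Require Import Defs.
From HB Require Import structures.
From mathcomp Require Import all_boot all_order all_algebra.
From mathcomp Require Import all_classical all_reals all_analysis.
From mathcomp Require Import measurable_realfun.
From mathcomp Require Import ring lra.

(** Write [a], [b] for the indicators of the phases [A n], [B n] and [V*w] for
    the integral of [w y * V x y] over [Omega].  On [A n] the equation is
    algebraic in the value [u n x]:
      [u n = (J*(a u) + R*(b u) - f) / (J*a + R*b)],
    and similarly on [B n] with [(R, G)] in place of [(J, R)]
    ([neumann_ratio]).  All the oscillation of [u n] therefore sits in the
    factors [a] and [b]: integration against a continuous kernel turns weak
    convergence into pointwise convergence, so both quotients converge
    pointwise on [Omega], say to [qA] and [qB] ([ratio_cvg]).  They are also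
    dominated by a multiple of [1 + |f|], uniformly in [n]
    ([ratio_bounded]).  For this
    - the numerators need a bound on the L1 norms of [a u] and [b u]; it
      follows from weak convergence by uniform boundedness
      ([L1_uniform_boundedness]);
    - the denominators need a positive lower bound; as [a + b = 1], both are at
      least the integral over [Omega] of [min J (min R G)], which is continuous
      and positive on the compact closure of [Omega] ([two_phase_coercive]).

    A pointwise convergent dominated sequence times a weakly-* convergent one
    converges weakly to the product of the limits ([oscillating_weak_limit]),
    hence [uA = X * qA] and [uB = (1 - X) * qB] almost everywhere.  So the
    corrector is [a * qA + b * qB], and its difference with [u n] is
    [a * (qA_n - qA) + b * (qB_n - qB)], which tends to zero in L2 by dominated
    convergence.  Since [u n] has mean zero, the mean of the corrector tends to
    zero as well, and subtracting it changes nothing in the limit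
    ([Lnorm_on2_recentered_cvg0]).

    These arguments need that open sets are measurable, that bounded sets have
    finite measure and that nonempty open sets have positive measure, all of
    which follows from the definition of Lebesgue measure by countable covers
    and from the normalization of the kernels. *)

Import Order.TTheory GRing.Theory Num.Theory.
Import numFieldNormedType.Exports.
Local Open Scope classical_set_scope.
Local Open Scope ring_scope.

Set Implicit Arguments.
Unset Strict Implicit.

(** * Lebesgue measure and open sets *)

Section lebesgue_topology.
Context {K : realType} {N : nat}.
Local Notation E := 'rV[K]_N.+1.

Let cut (i : 'I_N.+1) (t : K) (x : E) : E :=
  \row_j if j == i then t else x ord0 j.

(** Cutting each box of a cover along the hyperplane [x i = t] yields covers of
    the two sides without changing the total volume, which is the Caratheodory
    condition. *)
Lemma measurable_halfspace (i : 'I_N.+1) (t : K) :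
  measurable [set x : E | x ord0 i <= t].
Proof.
apply: (@le_caratheodory_measurable K E (@lebesgue_outer K N)) => S.
set H := [set x : E | _].
pose lo (c : E * E) : E * E := (c.1, cut i (Num.min (c.2 ord0 i) t) c.2).
pose hi (c : E * E) : E * E := (cut i (Num.max (c.1 ord0 i) t) c.1, c.2).
have volE c : box_volume c = box_volume (lo c) + box_volume (hi c).
  rewrite /box_volume (bigD1 i)//= [X in _ = X + _](bigD1 i)//=.
  rewrite [X in _ = _ + X](bigD1 i)//= !mxE !eqxx.
  set p := \prod_(_ | _) _.
  rewrite [X in _ = _ * X + _](_ : _ = p); last first.
    by apply: eq_bigr => j ji; rewrite !mxE (negbTE ji).
  rewrite [X in _ = _ + _ * X](_ : _ = p); last first.
    by apply: eq_bigr => j ji; rewrite !mxE (negbTE ji).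
  rewrite -mulrDl; congr (_ * _).
  by rewrite /Num.max /Num.min; do ![case: ifPn]; lra.
have volge0 c : (0 <= (@box_volume K N c)%:E)%E by exact: box_volume_ge0.
apply: le_ereal_inf_tmp => _ [c Sc <-].
under eq_eseriesr do rewrite volE EFinD.
rewrite nneseriesD//; apply: leeD; apply: ereal_inf_lbound.
- exists (lo \o c) => //= x [/Sc[k _ /= xk] xt].
  exists k => //= j; have := xk j; rewrite !mxE.
  case: eqP => [->|//]; rewrite !in_itv/= le_min => /andP[-> ->].
  by rewrite xt.
- exists (hi \o c) => //= x [/Sc[k _ /= xk] xt].
  exists k => //= j; have := xk j; rewrite !mxE.
  case: eqP => [->|//]; rewrite !in_itv/= gt_max => /andP[-> ->].
  by rewrite andbT/=; move/negP: xt; rewrite -ltNge.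
Qed.

Lemma measurable_box (c : E * E) : measurable (box c).
Proof.
rewrite (_ : box c = \bigcap_(i in [set: 'I_N.+1])
    ([set x : E | x ord0 i <= c.2 ord0 i] `&`
     ~` [set x : E | x ord0 i <= c.1 ord0 i])).
  apply: fin_bigcap_measurable => // i _.
  apply: measurableI; first exact: measurable_halfspace.
  exact/measurableC/measurable_halfspace.
apply/seteqP; split=> [x cx i _|x cx i]/=.
  have := cx i; rewrite in_itv/= => /andP[h ->]; split=> //.
  by apply/negP; rewrite -ltNge.
by have [/= h1 /negP] := cx i I; rewrite in_itv/= h1 andbT ltNge.
Qed.

Lemma lebesgue_box_le (c : E * E) : (lebesgue (box c) <= (box_volume c)%:E)%E.
Proof.
apply: ereal_inf_lbound => /=.
exists (fun k => if k == 0%N then c else (0, 0)).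
  by move=> x cx; exists 0%N.
rewrite nneseries_recl//; last by move=> k _; exact: box_volume_ge0.
by rewrite eqxx eseries0 ?adde0// => -[|k]// _ _ /=; rewrite box_volume00.
Qed.

Lemma lebesgue_bounded_fin (S : set E) : bounded_set S -> (lebesgue S < +oo)%E.
Proof.
move=> /pinfty_ex_gt0[M M0 SM].
pose c : E * E := (const_mx (- (M + 1)), const_mx (M + 1)).
apply: (@le_lt_trans _ _ (lebesgue (box c))).
  apply: le_lebesgue_outer => x /SM /= xM i; rewrite !mxE in_itv/=.
  have : `|x ord0 i| <= M.
    apply: le_trans xM; rewrite [leRHS]/Num.norm/= mx_normrE.
    by apply/bigmax_geP; right; exists (ord0, i).
  by rewrite ler_norml => /andP[]; lra.
by apply: le_lt_trans (lebesgue_box_le c) _; rewrite ltry.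
Qed.

Definition rat_box (q : 'rV[rat]_N.+1 * 'rV[rat]_N.+1) : E * E :=
  (map_mx ratr q.1, map_mx ratr q.2).

Lemma rat_box_nbhs (x : E) (U : set E) : nbhs x U ->
  exists q, [/\ box (rat_box q) x, box (rat_box q) (rat_box q).2 &
    box (rat_box q) `<=` U].
Proof.
move=> /nbhs_ballP[e /= e0 eU].
have lo i : exists r : rat, x ord0 i - e / 2 < ratr r < x ord0 i.
  have [|r] := @rat_in_itvoo K (x ord0 i - e / 2) (x ord0 i); first lra.
  by rewrite in_itv/=; exists r.
have hi i : exists r : rat, x ord0 i < ratr r < x ord0 i + e / 2.
  have [|r] := @rat_in_itvoo K (x ord0 i) (x ord0 i + e / 2); first lra.
  by rewrite in_itv/=; exists r.
have [l lP] := choice lo; have [h hP] := choice hi.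
exists (\row_i l i, \row_i h i); split=> [i|i|y yb].
- by rewrite !mxE in_itv/=; move: (lP i) (hP i) => /andP[_ ->] /andP[/ltW].
- rewrite !mxE in_itv/= lexx andbT.
  by move: (lP i) (hP i) => /andP[_ /lt_trans + /andP[+ _]]; apply.
- apply: eU; split=> // i j; rewrite ord1 /ball/=.
  have := yb j; rewrite !mxE in_itv/= => /andP[y1 y2].
  move: (lP j) (hP j) => /andP[? ?] /andP[? ?].
  by rewrite ltr_norml; apply/andP; split; lra.
Qed.

(** An open set is the union of the countably many rational boxes that it
    contains. *)
Lemma open_measurable_rV (U : set E) : open U -> measurable U.
Proof.
move=> oU.
pose F (k : nat) : set E := if unpickle k is Some q then
  (if `[< box (rat_box q) `<=` U >] then box (rat_box q) else set0) else set0.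
rewrite (_ : U = \bigcup_k F k).
  apply: bigcupT_measurable => k; rewrite /F; case: unpickle => // q.
  by case: ifPn => // _; exact: measurable_box.
apply/seteqP; split=> [x Ux|x [k _]]; last first.
  by rewrite /F; case: unpickle => // q; case: ifPn => [/asboolP qU /qU|].
have [q [qx _ qU]] := rat_box_nbhs (open_nbhs_nbhs (conj oU Ux)).
by exists (pickle q) => //; rewrite /F pickleK asboolT.
Qed.

Lemma continuous_measurable_rV (D : set E) (g : E -> K) :
  measurable D -> continuous g -> measurable_fun D g.
Proof.
move=> mD cg; apply: (measurability _ (RGenOpens.measurableE K)).
move=> _ [_ [a [b ->] <-]]; apply: measurableI => //.
apply: open_measurable_rV; apply: open_comp => //; exact: interval_open.
Qed.

Lemma lebesgue_translate_le (S : set E) (v : E) :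
  (lebesgue [set (x + v)%R | x in S] <= lebesgue S)%E.
Proof.
apply: le_ereal_inf_tmp => _ [c Sc <-]; apply: ereal_inf_lbound.
exists (fun k => ((c k).1 + v, (c k).2 + v)).
  move=> _ [x /Sc[k _ ck] <-]; exists k => // i.
  by have := ck i; rewrite !mxE !in_itv/= ltrD2r lerD2r.
apply: eq_eseriesr => k _; congr EFin; apply: eq_bigr => i _.
by rewrite !mxE; congr Num.max; lra.
Qed.

(** If a nonempty open set were null, so would be its countably many rational
    translates, and these cover the whole space. *)
Lemma lebesgue_open_gt0 (U : set E) : (0 < lebesgue [set: E])%E ->
  open U -> U !=set0 -> (0 < lebesgue U)%E.
Proof.
move=> T0 oU [u Uu]; rewrite lt0e; apply/andP; split; last exact: outer_measure_ge0.
apply/negP => /eqP U0; move: T0; apply/negP; rewrite -leNgt.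
pose q (k : nat) : 'rV[rat]_N.+1 := odflt 0 (unpickle k).
pose F (k : nat) : set E := [set x + map_mx ratr (q k) | x in U].
apply: (@le_trans _ _ (\sum_(k <oo) lebesgue (F k))%E); last first.
  rewrite eseries0// => k _ _; apply/eqP; rewrite eq_le outer_measure_ge0 andbT.
  by apply: le_trans (lebesgue_translate_le _ _) _; rewrite U0.
apply: (le_trans _ (lebesgue_outer_sigma_subadditive F)).
apply: le_lebesgue_outer => y _.
have : nbhs (y - u) [set z | U (y - z)].
  have : (fun z : E => y - z) @ (y - u) --> y - (y - u).
    apply: (@cvgB K E E (nbhs (y - u)) _ (fun=> y) id y (y - u)).
      exact: cvg_cst.
    exact: cvg_id.
  by rewrite subKr; apply; exact: open_nbhs_nbhs.
move=> /rat_box_nbhs[[q1 q2] [_ q2b qU]].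
exists (pickle q2) => //; exists (y - map_mx ratr q2); first exact: (qU _ q2b).
by rewrite /q pickleK/= subrK.
Qed.

End lebesgue_topology.

(** * Uniform boundedness in L1 *)

Lemma normr_lim_le (K : realType) (q_ : nat -> K) (q C : K) :
  q_ @ \oo --> q -> (forall n, `|q_ n| <= C) -> `|q| <= C.
Proof.
move=> qq qC.
have cq : `|q_ n| @[n --> \oo] --> `|q| by exact: cvg_norm.
rewrite -(cvg_lim _ cq)//; apply: limr_le; first by apply/cvg_ex; exists `|q|.
exact: nearW.
Qed.

Lemma cvg0_mul_bounded (K : realType) (a q_ : nat -> K) (q : K) :
  (forall n, `|a n| <= 1) -> q_ @ \oo --> q ->
  a n * (q_ n - q) @[n --> \oo] --> (0 : K).
Proof.
move=> a1 qq; apply/norm_cvg0P.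
have qq0 : `|q_ n - q| @[n --> \oo] --> (0 : K).
  apply/norm_cvg0P; rewrite -(subrr q).
  by apply: cvgB; [exact: qq|exact: cvg_cst].
apply: (squeeze_cvgr _ (cvg_cst 0) qq0); apply: nearW => n.
by rewrite normr_ge0/= normrM ler_piMl.
Qed.

Section bounded_multipliers.
Context d (T : measurableType d) (K : realType).
Variables (mu : {measure set T -> \bar K}) (D : set T).
Hypothesis mD : measurable D.
Implicit Types w phi : T -> K.

Lemma integrable_mulr_bounded w phi (M : K) :
  mu.-integrable D (EFin \o w) -> measurable_fun D phi ->
  (forall x, D x -> `|phi x| <= M) ->
  mu.-integrable D (EFin \o (fun x => w x * phi x)).
Proof.
move=> iw mphi phiM; apply: (integrableMl mD iw mphi).
exists M; split; first exact: num_real.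
by move=> L ML x Dx; apply: le_trans (phiM x Dx) (ltW ML).
Qed.

Lemma normr_Rintegral_mul_le w phi (M : K) :
  mu.-integrable D (EFin \o w) -> measurable_fun D phi ->
  (forall x, D x -> `|phi x| <= M) ->
  `|\int[mu]_(x in D) (w x * phi x)| <= M * \int[mu]_(x in D) `|w x|.
Proof.
move=> iw mphi phiM.
have iwphi := integrable_mulr_bounded iw mphi phiM.
apply: le_trans (le_normr_Rintegral mD iwphi) _.
have inw := integrable_norm iw.
rewrite -RintegralZl//; apply: le_Rintegral => //.
- exact: integrable_norm iwphi.
- exact: integrableZl inw.
- move=> x Dx; rewrite normrM mulrC ler_wpM2r//; exact: phiM.
Qed.

Lemma measurable_sgr w : measurable_fun D w ->
  measurable_fun D (fun x => Num.sg (w x)).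
Proof.
move=> mw; apply: measurableT_comp mw.
apply: nondecreasing_measurable => // x y xy.
by do ![case: sgrP => ?]; lra.
Qed.

(** Replacing [w] by [max w c] makes the inversion continuous on the whole
    line. *)
Lemma measurable_invr_ge w (c : K) : measurable_fun D w -> 0 < c ->
  (forall x, D x -> c <= w x) -> measurable_fun D (fun x => (w x)^-1).
Proof.
move=> mw c0 cw.
apply: (@eq_measurable_fun _ _ _ _ _ (fun x => (Num.max (w x) c)^-1)).
  by move=> x; rewrite inE => Dx; rewrite max_l// cw.
apply: (measurableT_comp (f := fun t : K => (Num.max t c)^-1)) mw.
apply: continuous_measurable_fun => t.
apply: (@cvgV K K (nbhs t) _ (fun t => Num.max t c)).
  by rewrite gt_eqF// lt_max c0 orbT.
by apply: (@continuous_max K K id (fun=> c)); [exact: cvg_id|exact: cst_continuous].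
Qed.

Lemma normr_sgr_le1 (t : K) : `|Num.sg t| <= 1.
Proof. by rewrite normr_sg; case: (_ == _). Qed.

End bounded_multipliers.

Section uniform_boundedness.
Context d (T : measurableType d) (K : realType).
Variables (mu : {measure set T -> \bar K}) (D : set T).
Hypothesis mD : measurable D.

(** Sokal's elementary proof of the uniform boundedness principle.  A test
    function is built as [sum of +- 3^-(k+1) sg (v k)], each sign being chosen so
    that the integral of [v k] against the sum up to its own term is at least
    [3^-(k+1)] times the L1 norm of [v k].  The remaining terms add up to at most
    half of that amount, so the integral against the full sum is still at least
    half as large.  Since the test functions are bounded, the series
    converges pointwise and uniformly. *)
Section gliding_hump.
Variable v : nat -> T -> K.
Hypothesis iv : forall k, mu.-integrable D (EFin \o v k).

Let r : K := 3%:R^-1.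

Let bump (k : nat) (b : bool) (s : T -> K) : T -> K :=
  fun x => s x + (-1) ^+ b * r ^+ k.+1 * Num.sg (v k x).

(** The plus sign is kept unless it fails to give the lower bound, in which case
    the minus sign does, the two integrals being [2 * r^(k+1) * |v k|_1] apart. *)
Fixpoint hump (k : nat) : T -> K :=
  if k is k'.+1 then
    bump k' (`|\int[mu]_(x in D) (v k' x * bump k' false (hump k') x)|
             < r ^+ k * \int[mu]_(x in D) `|v k' x|) (hump k')
  else fun=> 0.

Let r_gt0 : 0 < r. Proof. by rewrite invr_gt0. Qed.
Let rX_gt0 k : 0 < r ^+ k. Proof. exact: exprn_gt0. Qed.
Let r3 k : r ^+ k = 3%:R * r ^+ k.+1.
Proof. by rewrite exprS mulrA divff// mul1r. Qed.

Let hump_step k x : `|hump k.+1 x - hump k x| <= r ^+ k.+1.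
Proof.
rewrite /= /bump addrAC subrr add0r normrM.
rewrite -[leRHS]mulr1; apply: ler_pM => //; last exact: normr_sgr_le1.
by rewrite normrM normrX normrN1 expr1n mul1r gtr0_norm.
Qed.

Let measurable_bump k b s : measurable_fun D s -> measurable_fun D (bump k b s).
Proof.
move=> ms; apply: measurable_funD => //; apply: measurable_funM => //.
by apply: measurable_sgr; exact/measurable_EFinP/(measurable_int _ (iv k)).
Qed.

Let measurable_hump k : measurable_fun D (hump k).
Proof. by elim: k => [|k ih] //=; exact: measurable_bump. Qed.

(* The tail of the series after [k] terms is at most [r^k / 2]: the intervals
   [dn k x, up k x] are nested and shrink to the limit. *)
Let up k x := hump k x + r ^+ k / 2.
Let dn k x := hump k x - r ^+ k / 2.

Let up_noninc x : nonincreasing_seq (up ^~ x).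
Proof.
apply/nonincreasing_seqP => k; rewrite /up.
have := hump_step k x; rewrite ler_norml => /andP[_].
rewrite [in r ^+ k / 2]r3; lra.
Qed.

Let dn_nondec x : nondecreasing_seq (dn ^~ x).
Proof.
apply/nondecreasing_seqP => k; rewrite /dn.
have := hump_step k x; rewrite ler_norml => /andP[+ _].
rewrite [in r ^+ k / 2]r3; lra.
Qed.

Let dn_le_up x j k : dn j x <= up k x.
Proof.
apply: (@le_trans _ _ (dn (maxn j k) x)); first by apply: dn_nondec; exact: leq_maxl.
apply: (@le_trans _ _ (up (maxn j k) x)); last by apply: up_noninc; exact: leq_maxr.
by rewrite /dn /up; have := rX_gt0 (maxn j k); lra.
Qed.

Definition hump_lim (x : T) : K := inf (range (up ^~ x)).

Let up_cvg x : up ^~ x @ \oo --> hump_lim x.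
Proof.
apply: nonincreasing_cvgn => //.
by exists (dn 0 x) => _ [k _ <-]; exact: dn_le_up.
Qed.

Lemma hump_lim_close k x : `|hump_lim x - hump k x| <= r ^+ k / 2.
Proof.
have h1 : hump_lim x <= up k x.
  have <- : limn (up ^~ x) = hump_lim x by exact/cvg_lim.
  by apply: nonincreasing_cvgn_ge => //; apply/cvg_ex; exists (hump_lim x).
have h2 : dn k x <= hump_lim x.
  apply: lb_le_inf; first by exists (up 0 x), 0%N.
  by move=> _ [j _ <-]; exact: dn_le_up.
by move: h1 h2; rewrite /up /dn ler_norml; lra.
Qed.

Lemma measurable_hump_lim : measurable_fun D hump_lim.
Proof.
apply: (@measurable_fun_cvg _ _ _ D up) => // k.
by apply: measurable_funD => //; exact: measurable_hump.
Qed.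

Let hump_bound k x : `|hump k x| <= 1 / 2 - r ^+ k / 2.
Proof.
elim: k => [|k ih]; first by rewrite /= normr0 expr0 subrr.
have -> : hump k.+1 x = hump k x + (hump k.+1 x - hump k x) by rewrite addrC subrK.
apply: le_trans (ler_normD _ _) _.
have := hump_step k x; move: ih; rewrite [in r ^+ k / 2]r3; lra.
Qed.

Lemma hump_lim_le1 x : `|hump_lim x| <= 1.
Proof.
have := hump_lim_close 0 x; rewrite subr0 expr0.
lra.
Qed.

Let hump_large k : r ^+ k.+1 * \int[mu]_(x in D) `|v k x| <=
  `|\int[mu]_(x in D) (v k x * hump k.+1 x)|.
Proof.
rewrite /=; case: (ltP `|_| _) => // small.
set L := r ^+ k.+1 * _ in small *.
have ih b : mu.-integrable D (EFin \o (fun x => v k x * bump k b (hump k) x)).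
  apply: (@integrable_mulr_bounded _ _ _ mu D mD _ _ 2) => //.
    exact: measurable_bump.
  move=> x _; rewrite /bump.
  apply: le_trans (ler_normD _ _) _.
  have h1 := hump_bound k x; have h2 := rX_gt0 k; have h3 := rX_gt0 k.+1.
  suff : `|(-1) ^+ b * r ^+ k.+1 * Num.sg (v k x)| <= r ^+ k.+1.
    by move: h1 h2; have := r3 k; lra.
  rewrite normrM -[leRHS]mulr1; apply: ler_pM => //; last exact: normr_sgr_le1.
  by rewrite normrM normrX normrN1 expr1n mul1r gtr0_norm.
(* The two signs cannot both give a small integral. *)
have E : \int[mu]_(x in D) (v k x * bump k false (hump k) x) -
         \int[mu]_(x in D) (v k x * bump k true (hump k) x) = 2 * L.
  rewrite -RintegralB// mulrA -RintegralZl//; last exact: integrable_norm.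
  apply: eq_Rintegral => x _; rewrite /bump expr0 expr1 normrEsg; ring.
have := ler_normB (\int[mu]_(x in D) (v k x * bump k false (hump k) x))
         (\int[mu]_(x in D) (v k x * bump k true (hump k) x)).
rewrite E; have := ler_norm (2 * L); lra.
Qed.

Lemma hump_lim_large k : r ^+ k.+1 / 2 * \int[mu]_(x in D) `|v k x| <=
  `|\int[mu]_(x in D) (v k x * hump_lim x)|.
Proof.
have i1 : mu.-integrable D (EFin \o (fun x => v k x * hump_lim x)).
  apply: (@integrable_mulr_bounded _ _ _ mu D mD _ _ 1) => //.
    exact: measurable_hump_lim.
  by move=> x _; exact: hump_lim_le1.
have i2 : mu.-integrable D (EFin \o (fun x => v k x * hump k.+1 x)).
  apply: (@integrable_mulr_bounded _ _ _ mu D mD _ _ 1) => //.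
  by move=> x _; have := hump_bound k.+1 x; have := rX_gt0 k.+1; lra.
have : `|\int[mu]_(x in D) (v k x * (hump_lim x - hump k.+1 x))| <=
    r ^+ k.+1 / 2 * \int[mu]_(x in D) `|v k x|.
  apply: normr_Rintegral_mul_le => //; last by move=> x _; exact: hump_lim_close.
  apply: measurable_funB => //; exact: measurable_hump_lim.
under eq_Rintegral do rewrite mulrBr.
rewrite RintegralB//.
set a := \int[mu]_(x in D) (v k x * hump_lim x).
set b := \int[mu]_(x in D) (v k x * hump k.+1 x).
have := hump_large k; rewrite -/b.
have := ler_normB a (a - b); rewrite subKr.
set c := \int[mu]_(x in D) `|v k x|.
set t := r ^+ k.+1 * c.
rewrite (_ : r ^+ k.+1 / 2 * c = t / 2); last by rewrite /t; field.
lra.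
Qed.

End gliding_hump.

(** If the norms were unbounded, a subsequence with norms beyond [2 * 3^(k+1) * k]
    would have integrals beyond [k] against its own hump. *)
Lemma L1_uniform_boundedness (w : nat -> T -> K) :
  (forall n, mu.-integrable D (EFin \o w n)) ->
  (forall phi : T -> K, measurable_fun D phi -> (forall x, `|phi x| <= 1) ->
    exists C, forall n, `|\int[mu]_(x in D) (w n x * phi x)| <= C) ->
  exists C, forall n, \int[mu]_(x in D) `|w n x| <= C.
Proof.
move=> iw wb; apply: contrapT => /forallNP unb.
have /choice[n nP] : forall k, exists n,
    2 * 3 ^+ k.+1 * k%:R < \int[mu]_(x in D) `|w n x|.
  move=> k; have /existsNP[n] := unb (2 * 3 ^+ k.+1 * k%:R).
  by move/negP; rewrite -ltNge; exists n.
pose v k := w (n k).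
have iv k : mu.-integrable D (EFin \o v k) by exact: iw.
have [C CP] := wb _ (measurable_hump_lim iv) (hump_lim_le1 v).
pose k := Num.bound `|C|.
have := hump_lim_large iv k; have := CP (n k); rewrite -/(v k).
have : C < k%:R by apply: le_lt_trans (ler_norm C) (archi_boundP _).
have := nP k; rewrite -/(v k) => h Ck le1 le2.
suff : k%:R <= 3^-1 ^+ k.+1 / 2 * \int[mu]_(x in D) `|v k x| by lra.
rewrite exprVn -ler_pdivrMl; last by rewrite divr_gt0// invr_gt0 exprn_gt0.
apply: le_trans (ltW h); rewrite le_eqVlt; apply/orP; left; apply/eqP.
by field; rewrite expf_neq0.
Qed.

End uniform_boundedness.

(** * Integral operators with a continuous kernel *)

Section kernels.
Context {K : realType} {N : nat}.
Local Notation E := 'rV[K]_N.+1.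
Local Notation mu := (@lebesgue K N).

Lemma compact_closure_bounded (Omega : set E) :
  bounded_set Omega -> compact (closure Omega).
Proof.
move=> /pinfty_ex_gt0[M M0 OM]; apply: bounded_closed_compact; last exact: closed_closure.
exists M; split; first exact: num_real.
move=> L ML x Ox; apply: le_trans (ltW ML).
have cl : closed [set y : E | `|y| <= M].
  have /continuous_closedP := @norm_continuous K E.
  by move=> /(_ _ (@closed_le K M)).
by have := closure_subset (OM : Omega `<=` _) Ox; rewrite -(proj1 (closure_id _) cl).
Qed.

Lemma compact_kernel_bounded (V : E -> E -> K) (C : set E) :
  continuous (fun z : E * E => V z.1 z.2) -> compact C ->
  exists2 M, 0 < M & forall x y, C x -> C y -> `|V x y| <= M.
Proof.
move=> cV cC.
have /compact_bounded/pinfty_ex_gt0[M M0 VM] :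
    compact ((fun z : E * E => V z.1 z.2) @` (C `*` C)).
  by apply: continuous_compact (compact_setX cC cC); exact: continuous_subspaceT.
by exists M => // x y Cx Cy; apply: VM; exists (x, y).
Qed.

Lemma kernel_section_continuous (V : E -> E -> K) (x : E) :
  continuous (fun z : E * E => V z.1 z.2) -> continuous (V x).
Proof.
move=> cV y; apply: (@cvg_comp _ _ _ (fun y => (x, y)) (fun z => V z.1 z.2) _
  (nbhs (x, y))).
  apply: (@cvg_pair E E E (nbhs y) (nbhs x) (nbhs y) _ _ _ (fun=> x) id).
    exact: cvg_cst.
  exact: cvg_id.
exact: (cV (x, y)).
Qed.

(** The tube lemma: joint continuity is uniform along the compact factor. *)
Lemma kernel_uniform_near (V : E -> E -> K) (C : set E) (x : E) (e : K) :
  continuous (fun z : E * E => V z.1 z.2) -> compact C -> 0 < e ->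
  \forall x' \near x, forall y, C y -> `|V x' y - V x y| < e.
Proof.
move=> cV /compact_near_coveringP cC e0.
apply: (cC E (nbhs x) (fun x' y => `|V x' y - V x y| < e)) => y _.
have e20 : 0 < e / 2 by rewrite divr_gt0.
have /cvgrPdist_lt/(_ _ e20) := cV (x, y).
move=> [[U1 U2] /= [xU1 yU2] UV].
exists (U2, U1); first by [].
move=> [y' x'] /= [Uy' Ux'].
have h1 := UV (x', y') (conj Ux' Uy').
have h2 := UV (x, y') (conj (nbhs_singleton xU1) Uy').
rewrite /= in h1 h2.
have -> : V x' y' - V x y' = (V x y - V x y') - (V x y - V x' y') by ring.
by apply: le_lt_trans (ler_normB _ _) _; lra.
Qed.

Section kernel_operator.
Variable Omega : set E.
Hypotheses (oO : open Omega) (bO : bounded_set Omega).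

Let mO : measurable Omega := open_measurable_rV oO.
Let cO : compact (closure Omega) := compact_closure_bounded bO.

Definition kernel_op (V : E -> E -> K) (w : E -> K) (x : E) : K :=
  \int[lebesgue]_(y in Omega) (w y * V x y).

Variable V : E -> E -> K.
Hypothesis cV : continuous (fun z : E * E => V z.1 z.2).

Lemma measurable_kernel_section x : measurable_fun Omega (V x).
Proof. by apply: continuous_measurable_rV => //; exact: kernel_section_continuous. Qed.

Lemma kernel_section_bounded x : exists M, forall y, Omega y -> `|V x y| <= M.
Proof.
have /compact_bounded/pinfty_ex_gt0[M M0 VM] : compact (V x @` closure Omega).
  apply: continuous_compact cO; apply: continuous_subspaceT.
  exact: kernel_section_continuous.
by exists M => y Oy; apply: VM; exists y => //; exact: subset_closure.
Qed.

Lemma integrable_mul_kernel w x : mu.-integrable Omega (EFin \o w) ->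
  mu.-integrable Omega (EFin \o (fun y => w y * V x y)).
Proof.
move=> iw; have [M VM] := kernel_section_bounded x.
exact: integrable_mulr_bounded iw (measurable_kernel_section x) VM.
Qed.

Lemma continuous_kernel_op w : mu.-integrable Omega (EFin \o w) ->
  continuous (kernel_op V w).
Proof.
move=> iw x; apply/(@cvgrPdist_lt K K E (nbhs x)) => e e0.
set I := \int[mu]_(y in Omega) `|w y|.
have I0 : 0 <= I by exact: Rintegral_ge0.
have d0 : 0 < e / (I + 1) by rewrite divr_gt0// ltr_wpDl.
have := kernel_uniform_near x cV cO d0.
apply: filterS => x' xx'.
rewrite /kernel_op -RintegralB//; [|exact: integrable_mul_kernel..].
under eq_Rintegral do rewrite -mulrBr.
have : `|\int[mu]_(y in Omega) (w y * (V x y - V x' y))| <= e / (I + 1) * I.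
  apply: normr_Rintegral_mul_le => //.
    by apply: measurable_funB; exact: measurable_kernel_section.
  by move=> y Oy; rewrite distrC ltW// xx'//; exact: subset_closure.
move=> /le_lt_trans; apply.
rewrite -[ltRHS](@divfK _ (I + 1)); last by rewrite gt_eqF// ltr_wpDl.
by rewrite ltr_pM2l// ltrDl.
Qed.

(** The total mass is continuous and does not vanish on the closure of [Omega]:
    near a point [c] of the closure the kernel [V c] is positive on a
    neighbourhood of [c], which meets [Omega] in a nonempty open set.
    Compactness makes the bound uniform. *)
Lemma kernel_mass_gt0 : (0 < mu [set: E])%E ->
  (forall x y, 0 <= V x y) -> (forall x, 0 < V x x) ->
  exists2 del, 0 < del & forall x, Omega x -> del <= kernel_op V (fun=> 1) x.
Proof.
move=> T0 V0 Vxx.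
have [->|/set0P O0] := eqVneq Omega set0; first by exists 1.
have i1 : mu.-integrable Omega (EFin \o (fun=> 1)).
  apply: measurable_bounded_integrable => //; first exact: lebesgue_bounded_fin.
  exact: bounded_cst.
have [||c cO' cmin] := @EVT_min_rV K N.+1 (kernel_op V (fun=> 1)) _ _ cO.
- by move: O0 => [x Ox]; exists x; exact: subset_closure.
- by apply: continuous_subspaceT; exact: continuous_kernel_op.
exists (kernel_op V (fun=> 1) c); last first.
  by move=> x Ox; apply: cmin; rewrite inE; exact: subset_closure.
have e0 : 0 < V c c / 2 by rewrite divr_gt0.
pose U := [set y | V c c / 2 < V c y].
have oU : open U.
  apply: (@open_comp _ _ (V c) [set t | V c c / 2 < t]); last exact: open_gt.
  by move=> y _; exact: kernel_section_continuous.
have UO0 : U `&` Omega !=set0.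
  move: cO'; rewrite inE => cO'; rewrite setIC; apply: cO'.
  by apply: open_nbhs_nbhs; split => //; rewrite /U/=; have := Vxx c; lra.
have muU : (0 < mu (Omega `&` U))%E.
  by apply: lebesgue_open_gt0 => //; [exact: openI|rewrite setIC].
have finU : (mu (Omega `&` U) < +oo)%E.
  apply: le_lt_trans (lebesgue_bounded_fin bO).
  by apply: le_lebesgue_outer; exact: subIsetl.
have mU : measurable (Omega `&` U) by apply: open_measurable_rV; exact: openI.
apply: (@lt_le_trans _ _ (V c c / 2 * fine (mu (Omega `&` U)))).
  by apply: mulr_gt0 => //; apply: fine_gt0; rewrite muU.
rewrite -Rintegral_cst// Rintegral_mkcondr /kernel_op.
apply: le_Rintegral => //.
- rewrite -restrict_EFin; apply/integrable_restrict => //.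
    exact: open_measurable_rV.
  by apply: measurable_bounded_integrable => //; exact: bounded_cst.
- exact: integrable_mul_kernel.
- move=> y Oy; rewrite mul1r patchE; case: ifPn => //.
  by rewrite inE => /ltW.
Qed.

End kernel_operator.
End kernels.

(** * Dominated convergence and oscillating products *)

Section dominated_and_oscillating.
Context d (T : measurableType d) (K : realType).
Variables (mu : {measure set T -> \bar K}) (D : set T).
Hypothesis mD : measurable D.

Lemma Rintegral_dominated_cvg (f_ : nat -> T -> K) (f g : T -> K) :
  (forall n, measurable_fun D (f_ n)) -> measurable_fun D f ->
  {ae mu, forall x, D x -> f_ ^~ x @ \oo --> f x} ->
  mu.-integrable D (EFin \o g) ->
  {ae mu, forall x, D x -> forall n, `|f_ n x| <= g x} ->
  \int[mu]_(x in D) f_ n x @[n --> \oo] --> \int[mu]_(x in D) f x.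
Proof.
move=> mf_ mf f_f ig f_g.
have [||||if_f _ cvgI] := @dominated_convergence _ _ _ mu D mD
  (fun n => EFin \o f_ n) (EFin \o f) (EFin \o g) _ _ _ ig _.
- by move=> n; exact/measurable_EFinP.
- exact/measurable_EFinP.
- by apply: filterS f_f => x h Dx; apply: cvg_EFin (h Dx); exact: nearW.
- by apply: filterS f_g => x h n Dx /=; rewrite lee_fin; exact: h.
have fin := integrable_fin_num mD if_f.
by apply: fine_cvg; rewrite fineK.
Qed.

Lemma Rintegral_normr_eq0_ae (w : T -> K) :
  mu.-integrable D (EFin \o w) -> \int[mu]_(x in D) `|w x| = 0 ->
  {ae mu, forall x, D x -> w x = 0}.
Proof.
move=> iw w0.
have iabs := integrable_norm iw.
have : (\int[mu]_(x in D) `|(EFin \o w) x| = 0)%E.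
  transitivity (\int[mu]_(x in D) `|w x|)%:E; last by rewrite w0.
  by rewrite /Rintegral fineK//; exact: (integrable_fin_num mD iabs).
move=> /(ae_eq_integral_abs mu mD (measurable_int _ iw)).
by apply: filterS => x h Dx; have [] := h Dx.
Qed.

(** Split [a_n q_n = a_n (q_n - q) + a_n q]: the first term vanishes in the limit
    by dominated convergence, and in the second [q phi] is a fixed integrable
    test function for the weak-* limit.  Testing [U - th q] against its own sign
    then identifies it with zero. *)
Lemma oscillating_weak_limit (a q_ : nat -> T -> K) (th q U F : T -> K) :
  (forall n, measurable_fun D (a n)) -> (forall n x, D x -> `|a n x| <= 1) ->
  measurable_fun D th -> (forall x, D x -> `|th x| <= 1) ->
  (forall phi : T -> K, mu.-integrable D (EFin \o phi) ->
    \int[mu]_(x in D) (a n x * phi x) @[n --> \oo] -->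
    \int[mu]_(x in D) (th x * phi x)) ->
  (forall n, measurable_fun D (q_ n)) -> measurable_fun D q ->
  (forall x, D x -> q_ ^~ x @ \oo --> q x) ->
  mu.-integrable D (EFin \o F) ->
  (forall n x, D x -> `|q_ n x| <= F x) ->
  mu.-integrable D (EFin \o U) ->
  (forall phi : T -> K, measurable_fun D phi -> (forall x, `|phi x| <= 1) ->
    \int[mu]_(x in D) (a n x * q_ n x * phi x) @[n --> \oo] -->
    \int[mu]_(x in D) (U x * phi x)) ->
  {ae mu, forall x, D x -> U x = th x * q x}.
Proof.
move=> ma a1 mth th1 wstar mq_ mq q_q iF q_F iU wlim.
have qF x : D x -> `|q x| <= F x.
  by move=> Dx; apply: normr_lim_le (q_q x Dx) _ => n; exact: q_F.
have iq : mu.-integrable D (EFin \o q).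
  apply: le_integrable iF => //; first exact/measurable_EFinP.
  by move=> x Dx /=; rewrite lee_fin (le_trans (qF x Dx))// ler_norm.
have mU : measurable_fun D U by exact/measurable_EFinP/(measurable_int _ iU).
have ithq : mu.-integrable D (EFin \o (fun x => q x * th x)).
  exact: (integrable_mulr_bounded mD iq mth th1).
have key (phi : T -> K) : measurable_fun D phi -> (forall x, `|phi x| <= 1) ->
    \int[mu]_(x in D) (U x * phi x) = \int[mu]_(x in D) (q x * th x * phi x).
  move=> mphi phi1.
  have iqphi : mu.-integrable D (EFin \o (fun x => q x * phi x)).
    by apply: (integrable_mulr_bounded mD iq mphi) => x _; exact: phi1.
  suff wlim' : \int[mu]_(x in D) (a n x * q_ n x * phi x) @[n --> \oo] -->
      \int[mu]_(x in D) (q x * th x * phi x).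
    exact: (cvg_unique _ (wlim _ mphi phi1) wlim').
  have c1 := wstar _ iqphi.
  have c2 : \int[mu]_(x in D) (a n x * (q_ n x - q x) * phi x) @[n --> \oo]
     --> \int[mu]_(x in D) (0 : K).
    apply: (@Rintegral_dominated_cvg _ _ (fun x => 2 * F x)) => //.
    - move=> n; apply: measurable_funM => //; apply: measurable_funM => //.
      exact: measurable_funB.
    - apply: aeW => x Dx; rewrite -(mul0r (phi x)).
      apply: cvgM; last exact: cvg_cst.
      by apply: cvg0_mul_bounded; [move=> n; exact: a1|exact: q_q].
    - exact: integrableZl iF.
    - apply: aeW => x Dx n; rewrite !normrM -[leRHS]mulr1.
      apply: ler_pM => //.
      apply: (@le_trans _ _ `|q_ n x - q x|); first by rewrite ler_piMl// a1.
      apply: le_trans (ler_normB _ _) _.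
      by have := q_F n x Dx; have := qF x Dx; lra.
  have -> : \int[mu]_(x in D) (q x * th x * phi x) =
      \int[mu]_(x in D) (0 : K) + \int[mu]_(x in D) (th x * (q x * phi x)).
    rewrite Rintegral_cst// mul0r add0r.
    by apply: eq_Rintegral => x _; ring.
  rewrite (_ : (fun n => _) = (fun n =>
      \int[mu]_(x in D) (a n x * (q_ n x - q x) * phi x) +
      \int[mu]_(x in D) (a n x * (q x * phi x)))); first exact: cvgD c2 c1.
  apply/funext => n.
  have iFq : mu.-integrable D (EFin \o (fun x => q_ n x * (a n x * phi x))).
    have iq_n : mu.-integrable D (EFin \o q_ n).
      apply: le_integrable iF => //; first exact/measurable_EFinP.
      by move=> x Dx /=; rewrite lee_fin (le_trans (q_F n x Dx))// ler_norm.
    apply: (@integrable_mulr_bounded _ _ _ mu D mD _ _ 1) => //.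
      exact: measurable_funM.
    by move=> x Dx; rewrite normrM -[leRHS]mulr1; apply: ler_pM => //; exact: a1.
  have iqn : mu.-integrable D (EFin \o (fun x => q x * (a n x * phi x))).
    apply: (@integrable_mulr_bounded _ _ _ mu D mD _ _ 1) => //.
      exact: measurable_funM.
    by move=> x Dx; rewrite normrM -[leRHS]mulr1; apply: ler_pM => //; exact: a1.
  rewrite -RintegralD//.
  - by apply: eq_Rintegral => x _; ring.
  - apply: eq_integrable (integrableB mD iFq iqn) => // x _.
    by rewrite /= -EFinB; congr EFin; ring.
  - by apply: eq_integrable iqn => // x _ /=; congr EFin; ring.
have idiff : mu.-integrable D (EFin \o (fun x => U x - q x * th x)).
  exact: (integrableB mD iU ithq).
have mdiff : measurable_fun D (fun x => U x - q x * th x).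
  exact/measurable_EFinP/(measurable_int _ idiff).
have int0 : \int[mu]_(x in D) `|U x - q x * th x| = 0.
  have msg := measurable_sgr mdiff.
  have := key _ msg (fun x => normr_sgr_le1 _).
  move=> /eqP; rewrite -subr_eq0 -RintegralB//; last 2 first.
  - by apply: (integrable_mulr_bounded mD iU msg) => x _; exact: normr_sgr_le1.
  - by apply: (integrable_mulr_bounded mD ithq msg) => x _; exact: normr_sgr_le1.
  move=> /eqP <-; apply: eq_Rintegral => x _.
  by rewrite -mulrBl [RHS]mulrC; exact: normrEsg.
have := Rintegral_normr_eq0_ae idiff int0.
by apply: filterS => x h Dx; apply/eqP; rewrite -subr_eq0 [th x * _]mulrC h.
Qed.

End dominated_and_oscillating.

(** * L2 spaces on a set of finite measure *)

Section function_spaces_facts.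
Context {K : realType} {N : nat}.
Local Notation E := 'rV[K]_N.+1.
Local Notation mu := (@lebesgue K N).
Variable Omega : set E.
Hypotheses (mO : measurable Omega) (finO : (mu Omega < +oo)%E).

Lemma integrable_cst_fin (c : K) : mu.-integrable Omega (EFin \o (fun=> c)).
Proof. by apply: measurable_bounded_integrable => //; exact: bounded_cst. Qed.

Lemma Lspace_on_measurable p (u : E -> K) :
  Lspace_on Omega p u -> measurable_fun Omega u.
Proof.
rewrite /Lspace_on/= => /sub_Lfun_mfun; rewrite inE => mu_.
exact/measurable_restrictT.
Qed.

Lemma Lspace_on2_sqr (u : E -> K) : Lspace_on Omega 2%:E u ->
  mu.-integrable Omega (EFin \o (fun x => u x ^+ 2)).
Proof.
move=> /Lfun2_integrable_sqr h; apply/integrable_mkcond => //.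
apply: eq_integrable h => // x _ /=.
by rewrite !patchE; case: ifPn => //= _; rewrite expr0n.
Qed.

Lemma sqr_integrable_integrable (u : E -> K) : measurable_fun Omega u ->
  mu.-integrable Omega (EFin \o (fun x => u x ^+ 2)) ->
  mu.-integrable Omega (EFin \o u).
Proof.
move=> mu_ iu2.
apply: (le_integrable mO _ _ (integrableD mO (integrable_cst_fin 1) iu2)).
  exact/measurable_EFinP.
move=> x Ox; rewrite /= lee_fin [leRHS]ger0_norm ?addr_ge0 ?sqr_ge0//.
have := sqr_ge0 (`|u x| - 1); rewrite sqrrB1 real_normK ?num_real//.
have := normr_ge0 (u x); have := sqr_ge0 (u x); lra.
Qed.

Lemma Lspace_on2_integrable (u : E -> K) : Lspace_on Omega 2%:E u ->
  mu.-integrable Omega (EFin \o u).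
Proof.
move=> u2; apply: sqr_integrable_integrable (Lspace_on2_sqr u2).
exact: Lspace_on_measurable u2.
Qed.

Lemma Lnorm_on2E (v : E -> K) :
  Lnorm_on Omega 2%:E v = ((\int[mu]_(x in Omega) (v x ^+ 2)%:E) `^ 2^-1)%E.
Proof.
rewrite /Lnorm_on unlock [in RHS]integral_mkcond; congr (_ `^ _)%E.
apply: eq_integral => x _ /=; rewrite !patchE.
by case: ifPn => _; rewrite ?powR_mulrn// ?normr0 ?real_normK ?num_real// expr0n.
Qed.

Lemma Lspace_on2_bounded (phi : E -> K) (M : K) : measurable_fun Omega phi ->
  (forall x, Omega x -> `|phi x| <= M) -> Lspace_on Omega 2%:E phi.
Proof.
move=> mphi phiM; rewrite /Lspace_on/= inE; apply/andP; split.
  by rewrite inE/=; exact: (proj1 (measurable_restrictT phi mO) mphi).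
rewrite inE /=; change (Lnorm_on Omega 2%:E phi < +oo)%E; rewrite Lnorm_on2E poweR_lty//.
apply: integrable_lty => //.
have i1phi := integrable_mulr_bounded mO (integrable_cst_fin 1) mphi phiM.
have := integrable_mulr_bounded mO i1phi mphi phiM.
by apply: eq_integrable => // x _ /=; rewrite mul1r.
Qed.

Lemma Lspace_on1_integrable (phi : E -> K) :
  mu.-integrable Omega (EFin \o phi) -> Lspace_on Omega 1%:E phi.
Proof.
move=> iphi; rewrite /Lspace_on/=; apply/Lfun1_integrable.
by rewrite -restrict_EFin; exact/(integrable_mkcond _ mO).
Qed.

Lemma Lnorm_on2_cvg0 (v e : nat -> E -> K) (F : E -> K) :
  (forall n, measurable_fun Omega (v n)) ->
  (forall n, measurable_fun Omega (e n)) ->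
  (forall n, {ae mu, forall x, Omega x -> v n x = e n x}) ->
  (forall x, Omega x -> e ^~ x @ \oo --> (0 : K)) ->
  (forall n x, Omega x -> `|e n x| <= F x) ->
  mu.-integrable Omega (EFin \o (fun x => F x ^+ 2)) ->
  Lnorm_on Omega 2%:E (v n) @[n --> \oo] --> 0%E.
Proof.
move=> mv me ve e0 eF iF.
have le2 n x : Omega x -> e n x ^+ 2 <= F x ^+ 2.
  move=> Ox; rewrite -[e n x ^+ 2]real_normK ?num_real// lerXn2r ?nnegrE ?eF//.
  exact: le_trans (eF n x Ox).
have me2 n : measurable_fun Omega (fun x => e n x ^+ 2) by exact: measurable_funX.
have ie n : mu.-integrable Omega (EFin \o (fun x => e n x ^+ 2)).
  apply: le_integrable iF => //; first exact/measurable_EFinP.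
  by move=> x Ox; rewrite /= lee_fin !ger0_norm ?sqr_ge0//; exact: le2.
have cvgI : \int[mu]_(x in Omega) (e n x ^+ 2) @[n --> \oo] --> (0 : K).
  have -> : (0 : K) = \int[mu]_(x in Omega) (0 : K) by rewrite Rintegral_cst// mul0r.
  apply: (Rintegral_dominated_cvg mO me2 _ _ iF) => //.
    apply: aeW => x Ox; rewrite -[0](mul0r (0 : K)).
    by under eq_fun do rewrite expr2; apply: cvgM; exact: e0.
  by apply: aeW => x Ox n; rewrite ger0_norm ?sqr_ge0//; exact: le2.
have LE n : Lnorm_on Omega 2%:E (v n) =
    (Num.sqrt (\int[mu]_(x in Omega) (e n x ^+ 2)))%:E.
  rewrite Lnorm_on2E (@ae_eq_integral _ _ _ mu Omega (fun x => (e n x ^+ 2)%:E))//.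
  - rewrite -(fineK (integrable_fin_num mO (ie n))) poweR_EFin powR12_sqrt//.
    by apply: fine_ge0; apply: integral_ge0 => x _; rewrite lee_fin sqr_ge0.
  - by apply/measurable_EFinP; exact: measurable_funX.
  - exact/measurable_EFinP.
  - by apply: filterS (ve n) => x h Ox; rewrite h.
under eq_fun do rewrite LE.
apply: cvg_EFin; first exact: nearW.
rewrite -(@sqrtr0 K).
exact: (cvg_comp _ _ cvgI (@sqrt_continuous K 0)).
Qed.

Lemma sqr_integrable_affine (g : E -> K) (a b : K) : measurable_fun Omega g ->
  mu.-integrable Omega (EFin \o (fun x => g x ^+ 2)) ->
  mu.-integrable Omega (EFin \o (fun x => (a + b * g x) ^+ 2)).
Proof.
move=> mg ig2.
have := integrableD mO (integrable_cst_fin (2 * a ^+ 2))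
  (integrableZl mO (2 * b ^+ 2) ig2).
apply: (le_integrable mO).
  apply/measurable_EFinP; apply: measurable_funX.
  exact: measurable_funD (@measurable_cst _ _ _ _ _ a)
    (measurable_funM (@measurable_cst _ _ _ _ _ b) mg).
move=> x Ox; rewrite /= lee_fin ger0_norm ?sqr_ge0//.
apply: le_trans (ler_norm _).
have := sqr_ge0 (a - b * g x); nra.
Qed.

(** The mean of [om n] is minus the integral of [e n], as [u n] has mean zero;
    hence it tends to zero and recentering costs nothing.  The function [e n] is
    a representative of [u n - om n] for which convergence and domination hold at
    every point of [Omega], not just almost everywhere. *)
Lemma Lnorm_on2_recentered_cvg0 (u om e : nat -> E -> K) (F : E -> K) :
  (forall n, mu.-integrable Omega (EFin \o u n)) ->
  (forall n, \int[mu]_(x in Omega) u n x = 0) ->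
  (forall n, measurable_fun Omega (om n)) ->
  (forall n, measurable_fun Omega (e n)) ->
  (forall n, {ae mu, forall x, Omega x -> u n x - om n x = e n x}) ->
  (forall x, Omega x -> e ^~ x @ \oo --> (0 : K)) ->
  (forall n x, Omega x -> `|e n x| <= F x) ->
  measurable_fun Omega F ->
  mu.-integrable Omega (EFin \o (fun x => F x ^+ 2)) ->
  Lnorm_on Omega 2%:E
      (fun x => u n x - (om n x - \int[mu]_(y in Omega) om n y))
    @[n --> \oo] --> 0%E.
Proof.
move=> iu u0 mom me uome e0 eF mF iF2.
have iF := sqr_integrable_integrable mF iF2.
have mu_ n : measurable_fun Omega (u n).
  exact/measurable_EFinP/(measurable_int _ (iu n)).
have ie n : mu.-integrable Omega (EFin \o e n).
  apply: (le_integrable mO _ _ iF); first exact/measurable_EFinP.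
  by move=> x Ox; rewrite /= lee_fin (le_trans (eF n x Ox))// ler_norm.
pose m n := \int[mu]_(x in Omega) om n x.
have mE n : m n = - \int[mu]_(x in Omega) e n x.
  have -> : m n = \int[mu]_(x in Omega) (u n x - e n x).
    congr fine; apply: (@ae_eq_integral _ _ _ mu Omega _ _ mO).
    - exact/measurable_EFinP.
    - by apply/measurable_EFinP; exact: measurable_funB.
    - by apply: filterS (uome n) => x h Ox; rewrite -(h Ox) subKr.
  by rewrite RintegralB// u0 sub0r.
have m_cvg : m @ \oo --> (0 : K).
  rewrite (_ : m = (fun n => - \int[mu]_(x in Omega) e n x)); last exact/funext.
  have -> : (0 : K) = - \int[mu]_(x in Omega) (0 : K).
    by rewrite Rintegral_cst// mul0r oppr0.
  apply: cvgN; apply: (Rintegral_dominated_cvg mO me _ _ iF) => //.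
    by apply: aeW => x Ox; exact: e0.
  by apply: aeW => x Ox n; exact: eF.
have [M M0 mM] : exists2 M, 0 < M & forall n, `|m n| <= M.
  have /cvgP/cvg_seq_bounded/pinfty_ex_gt0[M M0 mM] := m_cvg.
  by exists M => // n; exact: mM.
apply: (Lnorm_on2_cvg0 (e := fun n x => e n x + m n) (F := fun x => M + 1 * F x)).
- move=> n; apply: measurable_funB (mu_ n) _.
  exact: measurable_funB (mom n) (@measurable_cst _ _ _ _ _ (m n)).
- by move=> n; exact: measurable_funD.
- move=> n; apply: filterS (uome n) => x h Ox.
  by rewrite -(h Ox) opprB addrA addrAC.
- by move=> x Ox; rewrite -[0]addr0; apply: cvgD m_cvg; exact: e0.
- move=> n x Ox; apply: le_trans (ler_normD _ _) _.
  by rewrite mul1r addrC; apply: lerD; [exact: mM|exact: eF].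
- exact: sqr_integrable_affine.
Qed.

End function_spaces_facts.

(** * Weak convergence and quotients of kernel operators *)

Section weak_L1.
Context {K : realType} {N : nat}.
Local Notation E := 'rV[K]_N.+1.
Local Notation mu := (@lebesgue K N).
Variable Omega : set E.
Hypotheses (oO : open Omega) (bO : bounded_set Omega).

Let mO : measurable Omega := open_measurable_rV oO.
Let finO : (mu Omega < +oo)%E := lebesgue_bounded_fin bO.

(** Weak convergence in L1, tested on bounded functions.  It is the common weaker
    form of the weak L2 convergence of [\1_(A n) * u n] and of the weak-*
    convergence of [\1_(A n)], so that kernel operators applied to either are
    handled at once. *)
Definition weak_cvg_L1 (v : nat -> E -> K) (w : E -> K) : Prop :=
  [/\ forall n, mu.-integrable Omega (EFin \o v n),
      mu.-integrable Omega (EFin \o w) &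
      forall (phi : E -> K) (M : K), measurable_fun Omega phi ->
        (forall x, Omega x -> `|phi x| <= M) ->
        \int[mu]_(x in Omega) (v n x * phi x) @[n --> \oo] -->
        \int[mu]_(x in Omega) (w x * phi x)].

Lemma weak_cvg_L2_L1 v w : weak_cvg_L2 Omega v w -> weak_cvg_L1 v w.
Proof.
move=> [v2 w2 vw]; split.
- by move=> n; exact: Lspace_on2_integrable.
- exact: Lspace_on2_integrable.
- by move=> phi M mphi phiM; apply: vw; exact: Lspace_on2_bounded phiM.
Qed.

Lemma weak_cvg_L1_bounded v w : weak_cvg_L1 v w ->
  exists C, forall n, \int[mu]_(x in Omega) `|v n x| <= C.
Proof.
move=> [iv _ vw]; apply: (L1_uniform_boundedness mO iv) => phi mphi phi1.
have := vw phi 1 mphi (fun x _ => phi1 x).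
move=> /cvgP/cvg_seq_bounded/pinfty_ex_gt0[C _ CP].
by exists C => n; exact: CP.
Qed.

Section operator.
Variable V : E -> E -> K.
Hypothesis cV : continuous (fun z : E * E => V z.1 z.2).

Lemma kernel_op_cvg v w x : weak_cvg_L1 v w ->
  kernel_op Omega V (v n) x @[n --> \oo] --> kernel_op Omega V w x.
Proof.
move=> [_ _ vw]; have [M VM] := kernel_section_bounded bO cV x.
by apply: vw VM; exact: measurable_kernel_section.
Qed.

Lemma kernel_op_bounded v w : weak_cvg_L1 v w ->
  exists2 C, 0 <= C & forall n x, Omega x -> `|kernel_op Omega V (v n) x| <= C.
Proof.
move=> vw; have [C vC] := weak_cvg_L1_bounded vw; have [iv _ _] := vw.
have [M M0 VM] := compact_kernel_bounded cV (compact_closure_bounded bO).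
exists (M * C).
  by rewrite mulr_ge0 ?(ltW M0)//; apply: le_trans (vC 0%N); exact: Rintegral_ge0.
move=> n x Ox; apply: (@le_trans _ _ (M * \int[mu]_(x in Omega) `|v n x|)).
  apply: normr_Rintegral_mul_le => //; first exact: measurable_kernel_section.
  by move=> y Oy; apply: VM; exact: subset_closure.
by rewrite ler_wpM2l ?(ltW M0).
Qed.

End operator.

(** The value forced on the solution in a phase whose points interact with the
    first phase through [P] and with the second one through [Q]; [a], [b] are the
    densities of the two phases and [w], [z] the parts of the solution that they
    carry. *)
Definition ratio (P Q : E -> E -> K) (a b w z f : E -> K) (x : E) : K :=
  (kernel_op Omega P w x + kernel_op Omega Q z x - f x) /
  (kernel_op Omega P a x + kernel_op Omega Q b x).

Section ratio.
Variables (P Q : E -> E -> K) (f : E -> K) (del : K).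
Hypotheses (cP : continuous (fun z : E * E => P z.1 z.2))
  (cQ : continuous (fun z : E * E => Q z.1 z.2)).
Hypotheses (mf : measurable_fun Omega f) (del0 : 0 < del).

Lemma measurable_ratio a b w z :
  mu.-integrable Omega (EFin \o a) -> mu.-integrable Omega (EFin \o b) ->
  mu.-integrable Omega (EFin \o w) -> mu.-integrable Omega (EFin \o z) ->
  (forall x, Omega x -> del <= kernel_op Omega P a x + kernel_op Omega Q b x) ->
  measurable_fun Omega (ratio P Q a b w z f).
Proof.
move=> ia ib iw iz abdel.
have mop V v : continuous (fun z : E * E => V z.1 z.2) ->
    mu.-integrable Omega (EFin \o v) -> measurable_fun Omega (kernel_op Omega V v).
  by move=> cV iv; apply: continuous_measurable_rV => //; exact: continuous_kernel_op.
apply: measurable_funM.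
  apply: measurable_funB => //; apply: measurable_funD; exact: mop.
apply: measurable_invr_ge del0 abdel.
by apply: measurable_funD; exact: mop.
Qed.

Variables (a b w z : nat -> E -> K) (X Y uA uB : E -> K).
Hypotheses (aX : weak_cvg_L1 a X) (bY : weak_cvg_L1 b Y)
  (wuA : weak_cvg_L1 w uA) (zuB : weak_cvg_L1 z uB).
Hypothesis abdel : forall n x, Omega x ->
  del <= kernel_op Omega P (a n) x + kernel_op Omega Q (b n) x.

Let den_cvg x : kernel_op Omega P (a n) x + kernel_op Omega Q (b n) x @[n --> \oo]
  --> kernel_op Omega P X x + kernel_op Omega Q Y x.
Proof. by apply: cvgD; exact: kernel_op_cvg. Qed.

Lemma ratio_den_lim x : Omega x ->
  del <= kernel_op Omega P X x + kernel_op Omega Q Y x.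
Proof.
move=> Ox; rewrite -(cvg_lim _ (den_cvg (x := x)))//.
apply: limr_ge; first by apply/cvg_ex; eexists; exact: den_cvg.
by apply: nearW => n; exact: abdel.
Qed.

Lemma ratio_cvg x : Omega x ->
  ratio P Q (a n) (b n) (w n) (z n) f x @[n --> \oo] -->
  ratio P Q X Y uA uB f x.
Proof.
move=> Ox; apply: cvgM.
  apply: cvgB; last exact: cvg_cst.
  by apply: cvgD; exact: kernel_op_cvg.
apply: cvgV; last exact: den_cvg.
by rewrite gt_eqF// (lt_le_trans del0)// ratio_den_lim.
Qed.

Lemma ratio_bounded : exists2 C, 0 <= C & forall n x, Omega x ->
  `|ratio P Q (a n) (b n) (w n) (z n) f x| <= C * (1 + `|f x|).
Proof.
have [C C0 CP] := kernel_op_bounded cP wuA.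
have [C' C'0 CP'] := kernel_op_bounded cQ zuB.
exists ((C + C' + 1) / del); first by rewrite divr_ge0 ?(ltW del0)// !addr_ge0.
move=> n x Ox; rewrite /ratio normrM normfV.
have den0 := lt_le_trans del0 (abdel n Ox).
rewrite (gtr0_norm den0) mulrAC; apply: ler_pM => //.
- by rewrite invr_ge0 ltW.
- apply: le_trans (ler_normB _ _) _.
  have := ler_normD (kernel_op Omega P (w n) x) (kernel_op Omega Q (z n) x).
  have := CP n x Ox; have := CP' n x Ox; have := normr_ge0 (f x).
  have : 0 <= (C + C') * `|f x| by rewrite mulr_ge0// addr_ge0.
  nra.
- by rewrite lef_pV2// ?posrE//; exact: abdel.
Qed.

End ratio.
End weak_L1.

(** * The two-phase Neumann problem *)

Section two_phase_problem.
Context {K : realType} {N : nat}.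
Local Notation E := 'rV[K]_N.+1.
Local Notation mu := (@lebesgue K N).

(** The normalization of a kernel is what shows that the measure is not
    trivial. *)
Lemma lebesgue_space_gt0 (V : E -> E -> K) :
  admissible_kernel V -> (0 < mu [set: E])%E.
Proof.
move=> [cV _ _ _ V1]; rewrite lt0e measure_ge0 andbT; apply/eqP => T0.
have := V1 0; rewrite null_set_integral//.
  by move=> /eqP; rewrite eq_sym onee_eq0.
apply/measurable_EFinP; apply: continuous_measurable_rV => //.
exact: kernel_section_continuous.
Qed.

Variable Omega : set E.
Hypotheses (oO : open Omega) (bO : bounded_set Omega).

Let mO : measurable Omega := open_measurable_rV oO.
Let finO : (mu Omega < +oo)%E := lebesgue_bounded_fin bO.

Lemma indic_partition (A B : set E) x :
  Omega = A `|` B -> A `&` B = set0 -> Omega x -> \1_A x + \1_B x = 1 :> K.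
Proof.
move=> -> AB0; rewrite !indicE => -[xA|xB].
  have xB : ~ B x by move=> xB; suff : set0 x by []; rewrite -AB0.
  by rewrite (mem_set xA) (memNset xB) addr0.
have xA : ~ A x by move=> xA; suff : set0 x by []; rewrite -AB0.
by rewrite (mem_set xB) (memNset xA) add0r.
Qed.

Lemma normr_indic_le1 (S : set E) x : `|\1_S x : K| <= 1.
Proof. by rewrite indicE; case: (_ \in _); rewrite ?normr1 ?normr0. Qed.

Lemma measurable_indicator (S : set E) : measurable S ->
  measurable_fun Omega (\1_S : E -> K).
Proof. by move=> mS; exact: measurable_indic. Qed.

Lemma integrable_indicator (S : set E) : measurable S ->
  mu.-integrable Omega (EFin \o (\1_S : E -> K)).
Proof.
move=> mS; have := integrable_mulr_bounded mO (integrable_cst_fin mO finO 1)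
  (measurable_indicator mS) (fun x _ => normr_indic_le1 S x).
by apply: eq_integrable => // x _ /=; rewrite mul1r.
Qed.

Lemma integrable_indicatorM (S : set E) (u : E -> K) : measurable S ->
  mu.-integrable Omega (EFin \o u) ->
  mu.-integrable Omega (EFin \o (fun x => \1_S x * u x)).
Proof.
move=> mS iu; have := integrable_mulr_bounded mO iu
  (measurable_indicator mS) (fun x _ => normr_indic_le1 S x).
by apply: eq_integrable => // x _ /=; rewrite mulrC.
Qed.

Lemma Rintegral_phase (V : E -> E -> K) (S : set E) (u : E -> K) (x : E) :
  continuous (fun z : E * E => V z.1 z.2) -> measurable S -> S `<=` Omega ->
  mu.-integrable Omega (EFin \o u) ->
  \int[mu]_(y in S) (V x y * (u y - u x)) =
  kernel_op Omega V (fun y => \1_S y * u y) x - u x * kernel_op Omega V \1_S x.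
Proof.
move=> cV mS SO iu.
have iS := integrable_mul_kernel oO bO cV x (integrable_indicator mS).
have iSu := integrable_mul_kernel oO bO cV x (integrable_indicatorM mS iu).
rewrite /kernel_op -RintegralZl// -RintegralB//; last exact: integrableZl iS.
rewrite -[X in \int[mu]_(y in X) _ = _](setIidr SO) Rintegral_mkcondr.
apply: eq_Rintegral => y _; rewrite patchE indicE.
case: (_ \in _) => /=; first by ring.
by rewrite !mul0r mulr0 subrr.
Qed.

Lemma mixed_kernel_mass_ge (P Q V : E -> E -> K) (A B : set E) x :
  continuous (fun z : E * E => P z.1 z.2) ->
  continuous (fun z : E * E => Q z.1 z.2) ->
  continuous (fun z : E * E => V z.1 z.2) ->
  (forall y, V x y <= P x y) -> (forall y, V x y <= Q x y) ->
  measurable A -> measurable B -> Omega = A `|` B -> A `&` B = set0 ->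
  kernel_op Omega V (fun=> 1) x <=
  kernel_op Omega P \1_A x + kernel_op Omega Q \1_B x.
Proof.
move=> cP cQ cV VP VQ mA mB OAB AB0.
have iA := integrable_mul_kernel oO bO cP x (integrable_indicator mA).
have iB := integrable_mul_kernel oO bO cQ x (integrable_indicator mB).
rewrite /kernel_op -RintegralD//; apply: le_Rintegral => //.
- exact: (integrable_mul_kernel oO bO cV x (integrable_cst_fin mO finO 1)).
- exact: (integrableD mO iA iB).
move=> y Oy; rewrite mul1r -[V x y]mul1r -(indic_partition OAB AB0 Oy) mulrDl.
by apply: lerD; rewrite ler_wpM2l// indicE.
Qed.

(** As the phases partition [Omega], both denominators dominate the mass of the
    single kernel [min J (min R G)], which depends on neither [n] nor the
    phases. *)
Lemma two_phase_coercive (J G R : E -> E -> K) :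
  admissible_kernel J -> admissible_kernel G -> admissible_kernel R ->
  exists2 del, 0 < del & forall A B : set E, measurable A -> measurable B ->
    Omega = A `|` B -> A `&` B = set0 -> forall x, Omega x ->
    del <= kernel_op Omega J \1_A x + kernel_op Omega R \1_B x /\
    del <= kernel_op Omega R \1_A x + kernel_op Omega G \1_B x.
Proof.
move=> hJ [cG G0 Gxx _ _] [cR R0 Rxx _ _].
have T0 := lebesgue_space_gt0 hJ; have [cJ J0 Jxx _ _] := hJ.
pose V x y := Num.min (J x y) (Num.min (R x y) (G x y)).
have cV : continuous (fun z : E * E => V z.1 z.2).
  move=> z; apply: (@continuous_min K _ (fun z => J z.1 z.2)); first exact: cJ.
  apply: (@continuous_min K _ (fun z => R z.1 z.2)); first exact: cR.
  exact: cG.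
have [del del0 delV] : exists2 del, 0 < del &
    forall x, Omega x -> del <= kernel_op Omega V (fun=> 1) x.
  apply: kernel_mass_gt0 => //.
  - by move=> x y; rewrite /V !le_min J0 R0 G0.
  - by move=> x; rewrite /V !lt_min Jxx Rxx Gxx.
have VJ x y : V x y <= J x y by rewrite /V ge_min lexx.
have VR x y : V x y <= R x y by rewrite /V !ge_min lexx orbT.
have VG x y : V x y <= G x y by rewrite /V !ge_min lexx !orbT.
exists del => // A B mA mB OAB AB0 x Ox; split; apply: le_trans (delV x Ox) _.
- exact: (mixed_kernel_mass_ge cJ cR cV).
- exact: (mixed_kernel_mass_ge cR cG cV).
Qed.

(** At a point of a phase, every term carrying the indicator of the other one
    drops out, and what is left is a linear equation for the value [u x]. *)
Lemma neumann_ratio (J G R : E -> E -> K) (A B : set E) (f u : E -> K) x :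
  continuous (fun z : E * E => J z.1 z.2) ->
  continuous (fun z : E * E => G z.1 z.2) ->
  continuous (fun z : E * E => R z.1 z.2) ->
  measurable A -> measurable B -> Omega = A `|` B -> A `&` B = set0 ->
  mu.-integrable Omega (EFin \o u) ->
  0 < kernel_op Omega J \1_A x + kernel_op Omega R \1_B x ->
  0 < kernel_op Omega R \1_A x + kernel_op Omega G \1_B x ->
  f x = \1_A x * \int[lebesgue]_(y in A) (J x y * (u y - u x))
      + \1_A x * \int[lebesgue]_(y in B) (R x y * (u y - u x))
      + \1_B x * \int[lebesgue]_(y in A) (R x y * (u y - u x))
      + \1_B x * \int[lebesgue]_(y in B) (G x y * (u y - u x)) ->
  let w y := \1_A y * u y in let z y := \1_B y * u y in
  \1_A x * u x = \1_A x * ratio Omega J R \1_A \1_B w z f x /\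
  \1_B x * u x = \1_B x * ratio Omega R G \1_A \1_B w z f x.
Proof.
move=> cJ cG cR mA mB OAB AB0 iu dA dB fx w z.
have AO : A `<=` Omega by rewrite OAB; exact: subsetUl.
have BO : B `<=` Omega by rewrite OAB; exact: subsetUr.
move: fx; rewrite !Rintegral_phase// -/w -/z.
rewrite /ratio; set JA := kernel_op _ J \1_A x in dA *.
set RB := kernel_op _ R \1_B x in dA *.
set RA := kernel_op _ R \1_A x in dB *.
set GB := kernel_op _ G \1_B x in dB *.
have solve (t g d : K) : 0 < d -> g = t * d -> t = g / d.
  by move=> d0 ->; rewrite mulfK// gt_eqF.
rewrite !indicE; have [xA|xA] := boolP (x \in A).
  have xB : x \notin B.
    apply/negP => xB; suff : set0 x by [].
    by rewrite -AB0; split; exact/set_mem.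
  rewrite (negbTE xB)/= !mul1r !mul0r => fx; split=> //.
  by apply: solve => //; rewrite fx; ring.
have [xB|xB] := boolP (x \in B); last by rewrite !mul0r.
rewrite /= !mul1r !mul0r => fx; split=> //.
by apply: solve => //; rewrite fx; ring.
Qed.

(** Unlike [weakstar_cvg_Loo], this says nothing of membership in a Lebesgue
    space, so it passes directly to the complementary phase. *)
Definition weakstar (v : nat -> E -> K) (w : E -> K) : Prop :=
  forall phi : E -> K, mu.-integrable Omega (EFin \o phi) ->
    \int[mu]_(x in Omega) (v n x * phi x) @[n --> \oo] -->
    \int[mu]_(x in Omega) (w x * phi x).

Lemma weakstar_indic_weak_cvg_L1 (S : nat -> set E) (th : E -> K) :
  (forall n, measurable (S n)) -> measurable_fun Omega th ->
  (forall x, Omega x -> `|th x| <= 1) ->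
  weakstar (fun n => \1_(S n)) th -> weak_cvg_L1 Omega (fun n => \1_(S n)) th.
Proof.
move=> mS mth th1 Sth; split.
- by move=> n; exact: integrable_indicator.
- have := integrable_mulr_bounded mO (integrable_cst_fin mO finO 1) mth th1.
  by apply: eq_integrable => // x _ /=; rewrite mul1r.
- move=> phi M mphi phiM; apply: Sth.
  have := integrable_mulr_bounded mO (integrable_cst_fin mO finO 1) mphi phiM.
  by apply: eq_integrable => // x _ /=; rewrite mul1r.
Qed.

Lemma weakstar_complement (A B : nat -> set E) (X : E -> K) :
  (forall n, measurable (A n)) -> (forall n, measurable (B n)) ->
  (forall n, Omega = A n `|` B n) -> (forall n, A n `&` B n = set0) ->
  measurable_fun Omega X -> (forall x, Omega x -> `|X x| <= 1) ->
  weakstar (fun n => \1_(A n)) X ->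
  weakstar (fun n => \1_(B n)) (fun x => 1 - X x).
Proof.
move=> mA mB OAB AB0 mX X1 AX phi iphi.
have iX := integrable_mulr_bounded mO iphi mX X1.
have iXphi : mu.-integrable Omega (EFin \o (fun x => X x * phi x)).
  by apply: eq_integrable iX => // x _ /=; rewrite mulrC.
have -> : \int[mu]_(x in Omega) ((1 - X x) * phi x) =
    \int[mu]_(x in Omega) phi x - \int[mu]_(x in Omega) (X x * phi x).
  by rewrite -RintegralB//; apply: eq_Rintegral => x _; ring.
rewrite (_ : (fun n => _) = (fun n => \int[mu]_(x in Omega) phi x -
   \int[mu]_(x in Omega) (\1_(A n) x * phi x))).
  by apply: cvgB; [exact: cvg_cst|exact: AX].
apply/funext => n; rewrite -RintegralB//; last exact: integrable_indicatorM.
apply: eq_Rintegral => x; rewrite inE => Ox.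
have AB1 := indic_partition (OAB n) (AB0 n) Ox.
by rewrite -[X in _ = X - _]mul1r -mulrBl -AB1 addrAC subrr add0r.
Qed.

(** On the phases [S n] the functions [u n] coincide with the non-oscillating
    [q_ n], whose limit can be multiplied by the weak-* limit of the
    indicators. *)
Lemma phase_limit (S : nat -> set E) (u q_ : nat -> E -> K) (th q U F : E -> K) :
  (forall n, measurable (S n)) -> measurable_fun Omega th ->
  (forall x, Omega x -> `|th x| <= 1) -> weakstar (fun n => \1_(S n)) th ->
  (forall n, measurable_fun Omega (q_ n)) -> measurable_fun Omega q ->
  (forall x, Omega x -> q_ ^~ x @ \oo --> q x) ->
  mu.-integrable Omega (EFin \o F) ->
  (forall n x, Omega x -> `|q_ n x| <= F x) ->
  weak_cvg_L1 Omega (fun n x => \1_(S n) x * u n x) U ->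
  (forall n, {ae mu, forall x, Omega x -> \1_(S n) x * u n x = \1_(S n) x * q_ n x}) ->
  {ae mu, forall x, Omega x -> U x = th x * q x}.
Proof.
move=> mS mth th1 Sth mq_ mq q_q iF q_F [iSu iU SuU] Suq.
apply: (oscillating_weak_limit mO (a := fun n => \1_(S n)) (q_ := q_) (F := F)) => //.
  by move=> n x _; exact: normr_indic_le1.
move=> phi mphi phi1.
have := SuU phi 1 mphi (fun x _ => phi1 x).
rewrite (_ : (fun n => _) = (fun n =>
  \int[mu]_(x in Omega) (\1_(S n) x * q_ n x * phi x)))//.
apply/funext => n.
have mSu : measurable_fun Omega (fun x => \1_(S n) x * u n x).
  exact/measurable_EFinP/(measurable_int _ (iSu n)).
have mSq : measurable_fun Omega (fun x => \1_(S n) x * q_ n x).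
  exact: (measurable_funM (measurable_indicator (mS n)) (mq_ n)).
have mSuphi := measurable_funM mSu mphi.
have mSqphi := measurable_funM mSq mphi.
congr fine; apply: (@ae_eq_integral _ _ _ mu Omega _ _ mO).
- exact: (proj2 (measurable_EFinP _ _) mSuphi).
- exact: (proj2 (measurable_EFinP _ _) mSqphi).
- by apply: filterS (Suq n) => x h Ox; rewrite h.
Qed.

End two_phase_problem.

(** * Convergence of the corrector *)

Unset Implicit Arguments.
Set Strict Implicit.

Theorem theorem2p2 (K : realType) (N : nat)
    (Omega : set 'rV[K]_N.+1) (hOmega : bounded_domain Omega)
    (J G R : 'rV[K]_N.+1 -> 'rV[K]_N.+1 -> K)
    (hJ : admissible_kernel J) (hG : admissible_kernel G)
    (hR : admissible_kernel R)
    (A B : nat -> set 'rV[K]_N.+1)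
    (mA : forall n, measurable (A n)) (mB : forall n, measurable (B n))
    (hAB : forall n, Omega = A n `|` B n) (dAB : forall n, A n `&` B n = set0)
    (f : 'rV[K]_N.+1 -> K) (hf : mean_zero_L2 Omega f)
    (u : nat -> 'rV[K]_N.+1 -> K) (hu : forall n, mean_zero_L2 Omega (u n))
    (hsol : forall n, solves_neumann Omega J G R (A n) (B n) f (u n))
    (X : 'rV[K]_N.+1 -> K)
    (hX : weakstar_cvg_Loo Omega (fun n => \1_(A n)) X)
    (c0 c1 : K) (hc0 : 0 < c0) (hc1 : 0 < c1)
    (hXc : forall x, Omega x -> c0 <= X x <= 1 - c1)
    (uA uB : 'rV[K]_N.+1 -> K)
    (huA : weak_cvg_L2 Omega (fun n x => \1_(A n) x * u n x) uA)
    (huB : weak_cvg_L2 Omega (fun n x => \1_(B n) x * u n x) uB) :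
  Lnorm_on Omega 2%:E (fun x =>
      u n x - (corrector (A n) (B n) X uA uB x
               - \int[lebesgue]_(y in Omega) corrector (A n) (B n) X uA uB y))
    @[n --> \oo] --> 0%E.
Proof.
have [oO _ bO] := hOmega.
have mO := open_measurable_rV oO; have finO := lebesgue_bounded_fin bO.
have [[cJ _ _ _ _] [cG _ _ _ _] [cR _ _ _ _]] := And3 hJ hG hR.
set mu := (@lebesgue K N).
have [del del0 coer] := two_phase_coercive oO bO hJ hG hR.
have dA n x (Ox : Omega x) := (coer _ _ (mA n) (mB n) (hAB n) (dAB n) x Ox).1.
have dB n x (Ox : Omega x) := (coer _ _ (mA n) (mB n) (hAB n) (dAB n) x Ox).2.
have [_ /Lspace_on_measurable-/(_ mO) mX starA'] := hX.
have X1 x : Omega x -> `|X x| <= 1.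
  by move=> /hXc /andP[h1 h2]; rewrite ler_norml; lra.
have mY : measurable_fun Omega (fun x => 1 - X x) by exact: measurable_funB.
have Y1 x : Omega x -> `|1 - X x| <= 1.
  by move=> /hXc /andP[h1 h2]; rewrite ler_norml; lra.
have starA : weakstar Omega (fun n => \1_(A n)) X.
  by move=> phi iphi; apply: starA'; exact: Lspace_on1_integrable.
have starB := weakstar_complement oO mA mB hAB dAB mX X1 starA.
have aX := weakstar_indic_weak_cvg_L1 oO bO mA mX X1 starA.
have bY := weakstar_indic_weak_cvg_L1 oO bO mB mY Y1 starB.
have wA := weak_cvg_L2_L1 oO bO huA; have wB := weak_cvg_L2_L1 oO bO huB.
have mf := Lspace_on_measurable mO hf.1.
have if2 := Lspace_on2_sqr mO hf.1.
have if1 := Lspace_on2_integrable mO finO hf.1.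
have iu n := Lspace_on2_integrable mO finO (hu n).1.
pose w n x := \1_(A n) x * u n x; pose z n x := \1_(B n) x * u n x.
pose qA n := ratio Omega J R \1_(A n) \1_(B n) (w n) (z n) f.
pose qB n := ratio Omega R G \1_(A n) \1_(B n) (w n) (z n) f.
pose qA' := ratio Omega J R X (fun x => 1 - X x) uA uB f.
pose qB' := ratio Omega R G X (fun x => 1 - X x) uA uB f.
have [iuA iuB] : mu.-integrable Omega (EFin \o uA) /\ mu.-integrable Omega (EFin \o uB).
  by case: wA wB => [_ iuA _] [_ iuB _].
have [iX iY] : mu.-integrable Omega (EFin \o X) /\
    mu.-integrable Omega (EFin \o (fun x => 1 - X x)).
  by case: aX bY => [_ iX _] [_ iY _].
have mqA n : measurable_fun Omega (qA n).
  have [[ia _ _] [ib _ _]] := (aX, bY); have [[iw _ _] [iz _ _]] := (wA, wB).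
  exact: (measurable_ratio oO bO cJ cR mf del0 (ia n) (ib n) (iw n) (iz n) (dA n)).
have mqB n : measurable_fun Omega (qB n).
  have [[ia _ _] [ib _ _]] := (aX, bY); have [[iw _ _] [iz _ _]] := (wA, wB).
  exact: (measurable_ratio oO bO cR cG mf del0 (ia n) (ib n) (iw n) (iz n) (dB n)).
have mqA' : measurable_fun Omega qA'.
  apply: (measurable_ratio oO bO cJ cR mf del0 iX iY iuA iuB) => x Ox.
  exact: (ratio_den_lim oO bO cJ cR aX bY dA).
have mqB' : measurable_fun Omega qB'.
  apply: (measurable_ratio oO bO cR cG mf del0 iX iY iuA iuB) => x Ox.
  exact: (ratio_den_lim oO bO cR cG aX bY dB).
have qA_cvg x : Omega x -> qA ^~ x @ \oo --> qA' x.
  move=> Ox; exact: (ratio_cvg oO bO cJ cR del0 aX bY wA wB dA Ox).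
have qB_cvg x : Omega x -> qB ^~ x @ \oo --> qB' x.
  move=> Ox; exact: (ratio_cvg oO bO cR cG del0 aX bY wA wB dB Ox).
have [CA CA0 qA_bnd] := ratio_bounded oO bO f cJ cR del0 wA wB dA.
have [CB CB0 qB_bnd] := ratio_bounded oO bO f cR cG del0 wA wB dB.
have i1f : mu.-integrable Omega (EFin \o (fun x => 1 + `|f x|)).
  exact: (integrableD mO (integrable_cst_fin mO finO 1) (integrable_norm if1)).
have sol n : {ae mu, forall x, Omega x ->
    w n x = \1_(A n) x * qA n x /\ z n x = \1_(B n) x * qB n x}.
  apply: filterS (hsol n) => x h Ox.
  apply: (neumann_ratio oO bO cJ cG cR) => //; last exact: h.
  - exact: lt_le_trans (dA n x Ox).
  - exact: lt_le_trans (dB n x Ox).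
have limA : {ae mu, forall x, Omega x -> uA x = X x * qA' x}.
  apply: (phase_limit oO (S := A) (u := u) (q_ := qA)
    (F := fun x => CA * (1 + `|f x|))) => //.
  - exact: integrableZl i1f.
  - by move=> n; apply: filterS (sol n) => x h Ox; have [] := h Ox.
have limB : {ae mu, forall x, Omega x -> uB x = (1 - X x) * qB' x}.
  apply: (phase_limit oO (S := B) (u := u) (q_ := qB)
    (F := fun x => CB * (1 + `|f x|))) => //.
  - exact: integrableZl i1f.
  - by move=> n; apply: filterS (sol n) => x h Ox; have [] := h Ox.
(* The corrector and, almost everywhere, its difference with [u n]. *)
pose om n := corrector (A n) (B n) X uA uB.
pose e0 n x := \1_(A n) x * (qA n x - qA' x) + \1_(B n) x * (qB n x - qB' x).
have mom n : measurable_fun Omega (om n).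
  apply: measurable_funD; apply: measurable_funM.
  - apply: measurable_funM (measurable_indicator (mA n)) _.
    exact/measurable_EFinP/(measurable_int _ iuA).
  - by apply: (measurable_invr_ge mX hc0) => x /hXc/andP[].
  - apply: measurable_funM (measurable_indicator (mB n)) _.
    exact/measurable_EFinP/(measurable_int _ iuB).
  - by apply: (measurable_invr_ge mY hc1) => x /hXc/andP[_]; lra.
have me0 n : measurable_fun Omega (e0 n).
  apply: measurable_funD; apply: measurable_funM.
  - exact: measurable_indicator (mA n).
  - exact: measurable_funB (mqA n) mqA'.
  - exact: measurable_indicator (mB n).
  - exact: measurable_funB (mqB n) mqB'.
have e0E n : {ae mu, forall x, Omega x -> u n x - om n x = e0 n x}.
  move: (sol n) limA limB; apply: filterS3 => x hn hA hB Ox.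
  have [hw hz] := hn Ox; have [X0 XY] := andP (hXc x Ox).
  rewrite /om /corrector (hA Ox) (hB Ox) /e0.
  have -> : u n x = w n x + z n x.
    by rewrite /w /z -mulrDl (indic_partition (hAB n) (dAB n) Ox) mul1r.
  rewrite hw hz; field.
  by rewrite !gt_eqF//; lra.
have qA'_bnd x : Omega x -> `|qA' x| <= CA * (1 + `|f x|).
  by move=> Ox; apply: normr_lim_le (qA_cvg x Ox) _ => n; exact: qA_bnd.
have qB'_bnd x : Omega x -> `|qB' x| <= CB * (1 + `|f x|).
  by move=> Ox; apply: normr_lim_le (qB_cvg x Ox) _ => n; exact: qB_bnd.
(* Each of the two phases contributes a difference of two quotients. *)
pose C := 2 * (CA + CB).
have mnf : measurable_fun Omega (fun x => `|f x|) by exact: measurableT_comp mf.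
have mF : measurable_fun Omega (fun x => C + C * `|f x|).
  apply: measurable_funD (@measurable_cst _ _ _ _ _ C) _.
  exact: measurable_funM (@measurable_cst _ _ _ _ _ C) mnf.
have inf2 : mu.-integrable Omega (EFin \o (fun x => `|f x| ^+ 2)).
  by apply: eq_integrable if2 => // x _; rewrite /= real_normK ?num_real.
have iF2 := sqr_integrable_affine mO finO C C mnf inf2.
apply: (Lnorm_on2_recentered_cvg0 mO finO iu (fun n => (hu n).2) mom me0 e0E
  _ _ mF iF2).
- move=> x Ox; rewrite -[0]addr0; apply: cvgD; apply: cvg0_mul_bounded.
  + by move=> n; exact: normr_indic_le1.
  + exact: qA_cvg.
  + by move=> n; exact: normr_indic_le1.
  + exact: qB_cvg.
- move=> n x Ox; rewrite /e0 /C; apply: le_trans (ler_normD _ _) _.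
  have hA : `|\1_(A n) x * (qA n x - qA' x)| <= 2 * (CA * (1 + `|f x|)).
    rewrite normrM; apply: (@le_trans _ _ `|qA n x - qA' x|).
      by rewrite ler_piMl// normr_indic_le1.
    apply: le_trans (ler_normB _ _) _.
    by have := qA_bnd n x Ox; have := qA'_bnd x Ox; lra.
  have hB : `|\1_(B n) x * (qB n x - qB' x)| <= 2 * (CB * (1 + `|f x|)).
    rewrite normrM; apply: (@le_trans _ _ `|qB n x - qB' x|).
      by rewrite ler_piMl// normr_indic_le1.
    apply: le_trans (ler_normB _ _) _.
    by have := qB_bnd n x Ox; have := qB'_bnd x Ox; lra.
  lra.
Qed.
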